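(* Let $A = C(\mathbb{S}^1)$ be generated by the coordinate unitary $z$, and equip $A$ with the antipodal action $\alpha$ of $\mathbb{Z}/2\mathbb{Z}$, generated by $z \mapsto -z$, and the conjugation action $\beta$ of $\mathbb{Z}/2\mathbb{Z}$, generated by $z\mapsto z^*$. Then there is an $(\alpha,\widetilde{\alpha})$-equivariant, unital $*$-homomorphism from $A$ to $J(A,\beta)$. Here $\alpha$ is free and $\beta$ is not free; consequently, for commuting actions $\alpha, \beta$ of $\mathbb{Z}/k\mathbb{Z}$ on a unital $C^*$-algebra $A$ with $\alpha$ free, the condition that $\beta$ is not free is insufficient to guarantee that there are no $(\alpha,\widetilde{\alpha})$-equivariant, unital $*$-homomorphisms from $A$ to $J(A,\beta)$.
   Context: Let $k\ge 2$, let $\alpha$ and $\beta$ be commuting actions of $\mathbb{Z}/k\mathbb{Z}$ on a unital $C^*$-algebra $A$, and let $\omega = e^{2\pi i/k}$. The group $\Gamma=\mathbb{Z}/k\mathbb{Z}$ acting through $\beta$ is identified with the Pontryagin dual of the group $G=\mathbb{Z}/k\mathbb{Z}$ acting through $\alpha$. Freeness: for an action $\alpha$ of a finite abelian group $G$ on $A$ and a character $\gamma \in \widehat{G}$, let $A_\gamma = \{a \in A : \alpha_g(a) = \gamma(g)a \text{ for all } g \in G\}$. The action is free if $1 \in \overline{A_\gamma A_\gamma^*}$ for every $\gamma$, where $A_\gamma A_\gamma^*$ is the linear span of the products $ab^*$ with $a,b\in A_\gamma$. Crossed product: $A \rtimes_\beta \Gamma$ is generated by $A$ and $\Gamma$,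 where $\Gamma$ is a group of unitaries implementing $\beta$. Writing $\mu$ for the unitary corresponding to a generator, its elements are uniquely $\sum_{j=0}^{k-1} a_j\mu^j$ with $a_j \in A$. Both $A$ and $C^*(\Gamma)$ are regarded as unital subalgebras. Twisted join: $J(A,\beta) = \{f \in C([0,1], A\rtimes_\beta \Gamma) : f(0) \in C^*(\Gamma),\ f(1) \in A\}$. Action $\widetilde{\alpha}$: the action of $\mathbb{Z}/k\mathbb{Z}$ on $J(A,\beta)$ obtained by applying pointwise the action on $A\rtimes_\beta\Gamma$ generated by the automorphism $\sum_j a_j\mu^j \mapsto \sum_j \omega^j\alpha(a_j)\mu^j$, where $\alpha$ also denotes the automorphism generating the action $\alpha$. For $k=2$ this is $a_0+a_1\mu\mapsto \alpha(a_0)-\alpha(a_1)\mu$. A map $\phi$ is $(\sigma,\tau)$-equivariant if $\phi\circ\sigma_g = \tau_g\circ\phi$ for all group elements $g$. *)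

(* Defs.v *)
From HB Require Import structures.
From mathcomp Require Import all_boot all_order all_algebra.
From mathcomp Require Import complex.
From mathcomp Require Import all_classical all_reals all_analysis.
From mathcomp Require Import ring lra.

Set Implicit Arguments.
Unset Strict Implicit.
Unset Printing Implicit Defensive.

Import Order.TTheory GRing.Theory Num.Theory.
Import numFieldNormedType.Exports.

Local Open Scope classical_set_scope.
Local Open Scope ring_scope.

(* Unital C^*-algebras.  The product is part of the mixin, and the [pzRingType]
   structure is recovered on the carrier below, because Hierarchy Builder
   admits no join of rings with normed modules underneath [numDomainType].
   Norms over [R[i]] take their (real, nonnegative) values in [R[i]].  The zero
   algebra is not excluded. *)
HB.mixin Record isCStarAlgebra (R : realType) A
    of CompleteNormedModule R[i] A := {
  cs_mul : A -> A -> A;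
  cs_one : A;
  star : A -> A;
  cs_mulA : associative cs_mul;
  cs_mul1x : left_id cs_one cs_mul;
  cs_mulx1 : right_id cs_one cs_mul;
  cs_mulDl : left_distributive cs_mul +%R;
  cs_mulDr : right_distributive cs_mul +%R;
  cs_scaleAl : forall (c : R[i]) x y, c *: cs_mul x y = cs_mul (c *: x) y;
  cs_scaleAr : forall (c : R[i]) x y, c *: cs_mul x y = cs_mul x (c *: y);
  starK : involutive star;
  starD : {morph star : x y / x + y};
  starZ : forall (c : R[i]) x, star (c *: x) = c^* *: star x;
  cs_starM : forall x y, star (cs_mul x y) = cs_mul (star y) (star x);
  cs_normM : forall x y, `|cs_mul x y| <= `|x| * `|y|;
  cs_norm_star : forall x, `|cs_mul (star x) x| = `|x| ^+ 2
}.

#[short(type="cstarAlgType")]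
HB.structure Definition CStarAlgebra (R : realType) :=
  {A of CompleteNormedModule R[i] A & isCStarAlgebra R A}.

HB.instance Definition _ (R : realType) (A : cstarAlgType R) :=
  GRing.Zmodule_isPzRing.Build A
    cs_mulA cs_mul1x cs_mulx1 cs_mulDl cs_mulDr.

HB.mixin Record isCompactSpace X of Topological X := {
  compact_space : compact [set: X]
}.

#[short(type="compactSpaceType")]
HB.structure Definition CompactSpace :=
  {X of Topological X & isCompactSpace X}.

Section cstar_theory.
Variables (R : realType) (A : cstarAlgType R).
Implicit Types x y : A.

Lemma starM x y : star (x * y) = star y * star x.
Proof. exact: cs_starM. Qed.

Lemma star1 : star 1 = 1 :> A.
Proof. by rewrite -[LHS]mulr1 -[X in _ * X]starK -starM mulr1 starK. Qed.

Lemma cstar_scalerAl (c : R[i]) x y : c *: (x * y) = c *: x * y.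
Proof. exact: cs_scaleAl. Qed.

Lemma cstar_scalerAr (c : R[i]) x y : c *: (x * y) = x * (c *: y).
Proof. exact: cs_scaleAr. Qed.

Lemma cstar_normrM x y : `|x * y| <= `|x| * `|y|.
Proof. exact: cs_normM. Qed.

Lemma norm_star_mul x : `|star x * x| = `|x| ^+ 2.
Proof. exact: cs_norm_star. Qed.

Lemma norm_star x : `|star x| = `|x|.
Proof.
have le_star y : `|y| <= `|star y|.
  have [->|y0] := eqVneq y 0; first by rewrite normr0.
  have := cstar_normrM (star y) y; rewrite norm_star_mul expr2.
  by rewrite ler_pM2r // normr_gt0.
apply/eqP; rewrite eq_le le_star andbT.
by rewrite -{2}(starK x) le_star.
Qed.

End cstar_theory.

Section complex_complete.
Variable R : realType.

Lemma normc_leRI (z : R[i]) : `|z| <= (`|complex.Re z| + `|complex.Im z|)%:C%C.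
Proof.
rewrite [z in `|z|]complexE rmorphD /=.
apply: (le_trans (ler_normD _ _)); rewrite normrM lerD //.
- by rewrite normc_def /= expr0n /= addr0 sqrtr_sqr.
- by rewrite !normc_def /= !expr0n /= !addr0 add0r !expr1n sqrtr1 mul1r
             sqrtr_sqr.
Qed.

Lemma normc_geIm(z : R[i]) : `|complex.Im z|%:C%C <= `|z|.
Proof.
case: z => a b; rewrite normc_def lecR /= -sqrtr_sqr ler_wsqrtr //.
by rewrite lerDr sqr_ge0.
Qed.

Lemma ge0_ReE (z : R[i]) : 0 <= z -> (complex.Re z)%:C%C = z.
Proof. by case: z => a b; rewrite lecE /= => /andP[/eqP-> _]. Qed.

Lemma Re_continuous: continuous (@complex.Re R : R[i]^o -> R).
Proof.
move=> z A /nbhs_ballP[e /= e0 Ae]; apply/nbhs_ballP; exists e%:C%C => /=.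
  by rewrite ltcR.
move=> w; rewrite -ball_normE /= => zw; apply: Ae.
rewrite -ball_normE /= -raddfB -ltcR.
exact: le_lt_trans (normc_ge_Re _) zw.
Qed.

Lemma Im_continuous: continuous (@complex.Im R : R[i]^o -> R).
Proof.
move=> z A /nbhs_ballP[e /= e0 Ae]; apply/nbhs_ballP; exists e%:C%C => /=.
  by rewrite ltcR.
move=> w; rewrite -ball_normE /= => zw; apply: Ae.
rewrite -ball_normE /= -raddfB -ltcR.
exact: le_lt_trans (normc_geIm _) zw.
Qed.

Lemma complex_complete (F : set_system R[i]^o) :
  ProperFilter F -> cauchy F -> cvg F.
Proof.
move=> FF Fc.
have Fb (e : R) : 0 < e -> exists z : R[i]^o, F (ball z e%:C%C).
  move=> e0; have /cauchyP := Fc; apply.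
  by rewrite /= ltcR.
have cRe : cauchy (@complex.Re R @ F).
  apply/cauchyP => e /Fb[z Fz]; exists (complex.Re z).
  rewrite /nbhs /=; apply: filterS Fz => w.
  rewrite -!ball_normE /ball_ /= => zw.
  rewrite -ltcR; apply: le_lt_trans zw; rewrite -raddfB.
  exact: normc_ge_Re.
have cIm : cauchy (@complex.Im R @ F).
  apply/cauchyP => e /Fb[z Fz]; exists (complex.Im z).
  rewrite /nbhs /=; apply: filterS Fz => w.
  rewrite -!ball_normE /ball_ /= => zw.
  rewrite -ltcR; apply: le_lt_trans zw; rewrite -raddfB.
  exact: normc_geIm.
have Fa : cvg (@complex.Re R @ F) by exact: R_complete cRe.
set a := lim (@complex.Re R @ F) in Fa.
have Fb' : cvg (@complex.Im R @ F) by exact: R_complete cIm.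
set b := lim (@complex.Im R @ F) in Fb'.
apply/cvg_ex; exists ((a +i* b)%C : R[i]^o).
move=> A /nbhs_ballP[e /= e0 Ae].
have eE : e = (complex.Re e)%:C%C by rewrite ge0_ReE // ltW.
have e0' : 0 < complex.Re e / 2.
  by rewrite divr_gt0 //; move: e0; rewrite eE ltcR.
have Fa' : F [set w | `|a - complex.Re w| < complex.Re e / 2].
  by have := Fa _ (nbhsx_ballx a _ e0'); rewrite /nbhs /= -ball_normE.
have Fb'' : F [set w | `|b - complex.Im w| < complex.Re e / 2].
  by have := Fb' _ (nbhsx_ballx b _ e0'); rewrite /nbhs /= -ball_normE.
have FF' : Filter F := @filter_filter _ _ FF.
have FI := @filterI _ _ FF' _ _ Fa' Fb''.
rewrite /nbhs /=; apply: (@filterS _ _ FF' _ _ _ FI) => w [/= aw bw]; apply: Ae.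
rewrite -ball_normE /= (le_lt_trans (normc_leRI _)) // eE ltcR.
by rewrite [ltRHS]splitr !raddfB /= ltrD.
Qed.

End complex_complete.

(* [R[i]^o] itself cannot receive the instances below: the library already
   attaches complete structures to the regular module over a [realType]. *)
Definition cplx (R : realType) : Type := R[i]^o.

HB.instance Definition _ (R : realType) := NormedModule.copy (cplx R) R[i]^o.
HB.instance Definition _ (R : realType) :=
  Uniform_isComplete.Build (cplx R) (@complex_complete R).

Section complex_cstar.
Variable R : realType.
Implicit Types (c x y : R[i]^o).

Let scaleAl (c x y : R[i]^o) : c *: (x * y) = c *: x * y.
Proof. exact: mulrA. Qed.
Let scaleAr (c x y : R[i]^o) : c *: (x * y) = x * (c *: y).
Proof. exact: mulrCA. Qed.
Let conjZ (c : R[i]) (x : R[i]^o) : (c *: x)^* = c^* *: (x^* : R[i]^o).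
Proof. exact: rmorphM. Qed.
Let conjM (x y : R[i]^o) : (x * y)^* = y^* * x^*.
Proof. by rewrite mulrC rmorphM. Qed.
Let normM (x y : R[i]^o) : `|x * y| <= `|x| * `|y|.
Proof. by rewrite normrM. Qed.
Let norm_conj (x : R[i]^o) : `|x^* * x| = `|x| ^+ 2.
Proof. by rewrite normrM norm_conjC expr2. Qed.

HB.instance Definition _ :=
  @isCStarAlgebra.Build R (cplx R) ( *%R ) 1 (fun z => z^*)
    (@mulrA _) (@mul1r _) (@mulr1 _) (@mulrDl _) (@mulrDr _)
    scaleAl scaleAr (@conjCK _) (@rmorphD _ _ _) conjZ conjM normM norm_conj.

End complex_cstar.

Section cstar_continuity.
Variables (R : realType) (A : cstarAlgType R).

Lemma starB (x y : A) : star (x - y) = star x - star y.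
Proof. by rewrite starD -scaleN1r starZ rmorphN1 scaleN1r. Qed.

Lemma star_continuous : continuous (@star R A).
Proof.
move=> z V /nbhs_ballP[e /= e0 Ve]; apply/nbhs_ballP; exists e => //= w.
rewrite -ball_normE /= => zw; apply: Ve; rewrite -ball_normE /=.
by rewrite -starB norm_star.
Qed.

Lemma cstar_cvgM (T : Type) (F : set_system T) (FF : Filter F) (f g : T -> A)
    (a b : A) :
  f @ F --> a -> g @ F --> b -> (fun x => f x * g x) @ F --> a * b.
Proof.
move=> fa gb; apply/cvgrPdist_lt => e e0.
pose M : R[i] := `|a| + `|b| + 1.
have M0 : 0 < M by rewrite ltr_wpDl // addr_ge0.
have eM : 0 < e / 2 / M by rewrite !divr_gt0.
near=> x.
have fax : `|a - f x| < e / 2 / M.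
  by near: x; apply: cvgr_dist_lt.
have gbx : `|b - g x| < e / 2 / M.
  by near: x; apply: cvgr_dist_lt.
have gx1 : `|b - g x| < 1 by near: x; apply: cvgr_dist_lt.
have gxM : `|g x| <= M.
  rewrite -[g x](subKr b); apply: (le_trans (ler_normB _ _)).
  by rewrite /M -addrA; apply: ler_wpDl => //; apply: lerD => //; exact: ltW.
have -> : a * b - f x * g x = a * (b - g x) + (a - f x) * g x.
  by rewrite mulrBr mulrBl addrA subrK.
rewrite (le_lt_trans (ler_normD _ _)) // [ltRHS]splitr.
apply: ler_ltD.
  rewrite (le_trans (cstar_normrM _ _)) //.
  rewrite -[leRHS](divfK (lt0r_neq0 M0)) mulrC ler_pM // ?ltW //.
  by rewrite /M -addrA ltrDl ltr_wpDl.
rewrite (le_lt_trans (cstar_normrM _ _)) //.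
rewrite (@le_lt_trans _ _ (`|a - f x| * M)) //; first by rewrite ler_wpM2l.
by rewrite -ltr_pdivlMr.
Unshelve. all: by end_near. Qed.
End cstar_continuity.

(* C(X, B) for compact X, with pointwise operations and the supremum norm. *)
Definition cont_fun (R : realType) (X : compactSpaceType)
  (B : cstarAlgType R) : Type := continuousType X B.

Section cont_fun.
Variables (R : realType) (X : compactSpaceType) (B : cstarAlgType R).
Local Notation cf := (cont_fun X B).
HB.instance Definition _ := Choice.on cf.

Definition cf_fun (f : cf) : X -> B := f.
Coercion cf_fun : cont_fun >-> Funclass.

Implicit Types f g h : cf.

Lemma cf_ext f g : f =1 g -> f = g.
Proof. by move=> fg; apply/continuousEP. Qed.

Lemma cf_cont f : continuous f.
Proof. exact: cts_fun. Qed.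

Definition mkcf (f : X -> B) (fc : continuous f) : cf :=
  (mkcts fc : continuousType X B).

Let addc f g : continuous (fun x => f x + g x).
Proof. by move=> x; apply: cvgD; apply: cf_cont. Qed.
Let oppc f : continuous (fun x => - f x).
Proof. by move=> x; apply: cvgN; apply: cf_cont. Qed.
Let scalec (c : R[i]) f : continuous (fun x => c *: f x).
Proof. by move=> x; apply: cvgZr; apply: cf_cont. Qed.
Let mulc f g : continuous (fun x => f x * g x).
Proof. by move=> x; apply: cstar_cvgM; apply: cf_cont. Qed.
Let starc f : continuous (fun x => star (f x)).
Proof.
by move=> x; apply: continuous_comp; [exact: cf_cont|exact: star_continuous].
Qed.

Definition cf_zero : cf := mkcf (@cst_continuous X B 0).
Definition cf_one : cf := mkcf (@cst_continuous X B 1).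
Definition cf_add f g : cf := mkcf (@addc f g).
Definition cf_opp f : cf := mkcf (@oppc f).
Definition cf_scale c f : cf := mkcf (@scalec c f).
Definition cf_mul f g : cf := mkcf (@mulc f g).
Definition cf_star f : cf := mkcf (@starc f).

Let addA : associative cf_add.
Proof. by move=> f g h; apply: cf_ext => x; exact: addrA. Qed.
Let addC : commutative cf_add.
Proof. by move=> f g; apply: cf_ext => x; exact: addrC. Qed.
Let add0 : left_id cf_zero cf_add.
Proof. by move=> f; apply: cf_ext => x; exact: add0r. Qed.
Let addN : left_inverse cf_zero cf_opp cf_add.
Proof. by move=> f; apply: cf_ext => x; exact: addNr. Qed.

HB.instance Definition _ := GRing.isZmodule.Build cf addA addC add0 addN.

Let scaleA c d f : cf_scale c (cf_scale d f) = cf_scale (c * d) f.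
Proof. by apply: cf_ext => x; exact: scalerA. Qed.
Let scale1 : left_id 1 cf_scale.
Proof. by move=> f; apply: cf_ext => x; exact: scale1r. Qed.
Let scaleDr : right_distributive cf_scale +%R.
Proof. by move=> c f g; apply: cf_ext => x; exact: scalerDr. Qed.
Let scaleDl f : {morph cf_scale^~ f : c d / c + d}.
Proof. by move=> c d; apply: cf_ext => x; exact: scalerDl. Qed.

HB.instance Definition _ :=
  GRing.Zmodule_isLmodule.Build R[i] cf scaleA scale1 scaleDr scaleDl.

Definition cf_norm f : R[i] :=
  (sup [set complex.Re `|f x| | x in [set: X]])%:C%C.

Let has_ub_cf f : has_ubound [set complex.Re `|f x| | x in [set: X]].
Proof.
have fc : continuous (fun x => complex.Re `|f x|).
  move=> x.
  apply: (@continuous_comp _ _ _ (fun x => `|f x| : R[i]^o) (@complex.Re R)).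
    by apply: cvg_norm; exact: cf_cont.
  exact: Re_continuous.
have /compact_bounded : compact [set complex.Re `|f x| | x in [set: X]].
  by apply: continuous_compact compact_space; exact: continuous_subspaceT.
case=> M [_ MP]; exists (M + 1) => _ [x _ <-].
apply: (le_trans (ler_norm _)).
by apply: (MP (M + 1)); rewrite ?ltrDl //; exists x.
Qed.

Lemma cf_norm_ge f x : `|f x| <= cf_norm f.
Proof.
rewrite -[leLHS]ge0_ReE // lecR.
by apply: ub_le_sup; [exact: has_ub_cf|exists x].
Qed.

Lemma cf_norm_ge0 f : 0 <= cf_norm f.
Proof.
rewrite /cf_norm lecR.
have [[x _]|/set0P/negP/negPn/eqP X0] := pselect ([set: X] !=set0).
  by have := le_trans (normr_ge0 _) (cf_norm_ge f x); rewrite /cf_norm lecR.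
by rewrite X0 image_set0 sup0.
Qed.

Lemma cf_norm_le f (M : R[i]) : 0 <= M -> (forall x, `|f x| <= M) ->
  cf_norm f <= M.
Proof.
move=> M0 fM.
have ME : M = (complex.Re M)%:C%C by rewrite ge0_ReE.
rewrite /cf_norm ME lecR.
have [[x _]|/set0P/negP/negPn/eqP X0] := pselect ([set: X] !=set0).
  apply: ge_sup; first by exists (complex.Re `|f x|), x.
  by move=> _ [y _ <-]; rewrite -lecR ge0_ReE // -ME.
by rewrite X0 image_set0 sup0 -lecR -ME.
Qed.

Let norm_triangle f g : cf_norm (f + g) <= cf_norm f + cf_norm g.
Proof.
apply: cf_norm_le => [|x]; first by rewrite addr_ge0 // cf_norm_ge0.
by rewrite (le_trans (ler_normD _ _)) // lerD // cf_norm_ge.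
Qed.

Let norm_eq0 f : cf_norm f = 0 -> f = 0.
Proof.
move=> f0; apply: cf_ext => x; apply/eqP; rewrite -normr_le0 -f0.
exact: cf_norm_ge.
Qed.

Let norm_scale (c : R[i]) f : cf_norm (c *: f) = `|c| * cf_norm f.
Proof.
have le_sc (d : R[i]) g : cf_norm (d *: g) <= `|d| * cf_norm g.
  apply: cf_norm_le => [|x]; first by rewrite mulr_ge0 // cf_norm_ge0.
  by rewrite [`|_|]normrZ ler_wpM2l // cf_norm_ge.
apply/eqP; rewrite eq_le le_sc /=.
have [->|c0] := eqVneq c 0; first by rewrite normr0 mul0r cf_norm_ge0.
rewrite -ler_pdivlMl ?normr_gt0 // -normfV -{1}[f](scalerK c0).
exact: le_sc.
Qed.

HB.instance Definition _ :=
  Lmodule_isNormed.Build R[i] cf norm_triangle norm_scale norm_eq0.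

Let cf_complete (F : set_system cf) : ProperFilter F -> cauchy F -> cvg F.
Proof.
move=> FF Fc.
have Fb (e : R[i]) : 0 < e -> exists f : cf, F (ball f e).
  by move=> e0; have /cauchyP := Fc; apply.
have evE f g x : f x - g x = (f - g) x by [].
have cx x : cvg ((fun f : cf => f x) @ F).
  apply: cauchy_cvg; apply/cauchyP => e /Fb[f Ff]; exists (f x).
  rewrite /nbhs /=; apply: filterS Ff => g.
  rewrite -!ball_normE /ball_ /= => fg.
  by rewrite evE; apply: le_lt_trans fg; exact: cf_norm_ge.
pose g x : B := lim ((fun f : cf => f x) @ F).
have g_near f e : 0 < e -> F (ball f e) -> forall x, `|f x - g x| < e + e.
  move=> e0 Ff x.
  have Fg : F [set h : cf | `|g x - h x| < e].
    by have := cx x _ (nbhsx_ballx (g x) _ e0); rewrite /nbhs /= -ball_normE.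
  have [h [/= gh]] := filter_ex (filterI Fg Ff); rewrite -ball_normE /= => fh.
  rewrite -(subrKA (h x)) (le_lt_trans (ler_normD _ _)) // ltrD //.
    by rewrite evE; apply: le_lt_trans fh; exact: cf_norm_ge.
  by rewrite distrC.
have gc : continuous g.
  move=> x; apply/cvgrPdist_lt => e e0.
  have e50 : 0 < e / 5%:R by rewrite divr_gt0.
  have [f Ff] := Fb _ e50; have fg := g_near _ _ e50 Ff.
  near=> y.
  have fxy : `|f x - f y| < e / 5%:R.
    by near: y; apply: cvgr_dist_lt => //; exact: cf_cont.
  have -> : g x - g y = (g x - f x) + (f x - f y) + (f y - g y).
    by rewrite !subrKA.
  have -> : e = (e / 5%:R + e / 5%:R) + e / 5%:R + (e / 5%:R + e / 5%:R).
    by field.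
  rewrite (le_lt_trans (ler_normD _ _)) // ltrD //.
  rewrite (le_lt_trans (ler_normD _ _)) // ltrD //.
  by rewrite distrC.
apply/cvg_ex; exists (mkcf gc : cf).
move=> V /nbhs_ballP[e /= e0 Ve].
have e40 : 0 < e / 4%:R by rewrite divr_gt0.
have [f Ff] := Fb _ e40; have fg := g_near _ _ e40 Ff.
rewrite /nbhs /=; apply: filterS Ff => h; rewrite -ball_normE /= => fh.
apply: Ve; rewrite -ball_normE /=.
have e30 : 0 < e / 4%:R *+ 3 by rewrite pmulrn_lgt0.
apply: (@le_lt_trans _ _ (e / 4%:R *+ 3)); last first.
  have eE : e = e / 4%:R *+ 3 + e / 4%:R by field.
  by rewrite [ltRHS]eE ltrDl.
apply: cf_norm_le => [|x]; first exact: ltW.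
rewrite -[`|_|]/(`|g x - h x|) -(subrKA (f x)).
rewrite (le_trans (ler_normD _ _)) // mulrS addrC lerD //.
  by rewrite distrC mulr2n ltW.
by rewrite ltW // evE; apply: le_lt_trans fh; exact: cf_norm_ge.
Unshelve. all: by end_near. Qed.

HB.instance Definition _ := Uniform_isComplete.Build cf cf_complete.

Let mulA : associative cf_mul.
Proof. by move=> f g h; apply: cf_ext => x; exact: mulrA. Qed.
Let mul1 : left_id cf_one cf_mul.
Proof. by move=> f; apply: cf_ext => x; exact: mul1r. Qed.
Let mulx1 : right_id cf_one cf_mul.
Proof. by move=> f; apply: cf_ext => x; exact: mulr1. Qed.
Let mulDl : left_distributive cf_mul +%R.
Proof. by move=> f g h; apply: cf_ext => x; exact: mulrDl. Qed.
Let mulDr : right_distributive cf_mul +%R.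
Proof. by move=> f g h; apply: cf_ext => x; exact: mulrDr. Qed.
Let mulAl (c : R[i]) f g : c *: cf_mul f g = cf_mul (c *: f) g.
Proof. by apply: cf_ext => x; exact: cstar_scalerAl. Qed.
Let mulAr (c : R[i]) f g : c *: cf_mul f g = cf_mul f (c *: g).
Proof. by apply: cf_ext => x; exact: cstar_scalerAr. Qed.
Let cstarK : involutive cf_star.
Proof. by move=> f; apply: cf_ext => x; exact: starK. Qed.
Let cstarD : {morph cf_star : f g / f + g}.
Proof. by move=> f g; apply: cf_ext => x; exact: starD. Qed.
Let cstarZ (c : R[i]) f : cf_star (c *: f) = c^* *: cf_star f.
Proof. by apply: cf_ext => x; exact: starZ. Qed.
Let cstarM f g : cf_star (cf_mul f g) = cf_mul (cf_star g) (cf_star f).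
Proof. by apply: cf_ext => x; exact: starM. Qed.
Let normM f g : `|cf_mul f g| <= `|f| * `|g|.
Proof.
apply: cf_norm_le => [|x]; first by rewrite mulr_ge0.
by rewrite (le_trans (cstar_normrM _ _)) // ler_pM //; exact: cf_norm_ge.
Qed.
Let norm_star f : `|cf_mul (cf_star f) f| = `|f| ^+ 2.
Proof.
have cf0 h : 0 <= cf_norm h := cf_norm_ge0 h.
apply/eqP; rewrite eq_le; apply/andP; split.
  apply: cf_norm_le => [|x]; first by rewrite exprn_ge0.
  rewrite [`|_|]norm_star_mul lerXn2r ?nnegrE //; exact: cf_norm_ge.
set N := `|cf_mul _ _|; have N0 : 0 <= N by exact: cf_norm_ge0.
rewrite -(sqrtCK N) lerXn2r ?nnegrE ?sqrtC_ge0 //.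
apply: cf_norm_le => [|x]; first by rewrite sqrtC_ge0.
rewrite -(@ler_pXn2r _ 2) ?nnegrE ?sqrtC_ge0 // sqrtCK -norm_star_mul.
exact: (cf_norm_ge (cf_mul (cf_star f) f)).
Qed.

HB.instance Definition _ :=
  isCStarAlgebra.Build R cf mulA mul1 mulx1 mulDl mulDr mulAl mulAr
    cstarK cstarD cstarZ cstarM normM norm_star.

End cont_fun.

Lemma compact_set_type (X : topologicalType) (A : set X) :
  compact A -> compact [set: set_type A].
Proof.
move=> cA F FF _.
have vA : (set_val @ F) A.
  rewrite /nbhs /=; apply: filterS (@filterT _ F _) => x _.
  exact: set_valP.
have [p [Ap pF]] := cA (set_val @ F) _ vA.
exists (exist _ p (mem_set Ap) : set_type A); split=> //.
move=> B V FB [_ [[W oW <-] /= Wp] WV].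
have vB : (set_val @ F) (set_val @` B).
  by rewrite /nbhs /=; apply: filterS FB => x Bx; exists x.
have [_ [[b Bb <-] Wb]] := pF _ _ vB (open_nbhs_nbhs (conj oW Wp)).
by exists b; split=> //; exact: WV.
Qed.

Section circle.
Variable R : realType.

Definition circle_set : set R[i]^o := [set z : R[i]^o | `|z| = 1].
Definition circle : Type := set_type circle_set.
HB.instance Definition _ := Topological.on circle.

Let pair_cont : continuous (fun p : R * R => (p.1 +i* p.2)%C : R[i]^o).
Proof.
move=> p V /nbhs_ballP[e /= e0 Ve]; apply/nbhs_ballP.
have eE : e = (complex.Re e)%:C%C by rewrite ge0_ReE // ltW.
exists (complex.Re e / 2) => /=.
  by rewrite divr_gt0 //; move: e0; rewrite eE ltcR.
move=> q [/=]; rewrite -!ball_normE /= => p1 p2; apply: Ve.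
rewrite -ball_normE /= (le_lt_trans (normc_leRI _)) // eE ltcR.
by rewrite [ltRHS]splitr !raddfB /= ltrD.
Qed.

Lemma circle_set_compact : compact circle_set.
Proof.
have cI : compact `[(-1 : R), 1] by exact: segment_compact.
have cS := continuous_compact (continuous_subspaceT pair_cont)
  (compact_setX cI cI).
apply: subclosed_compact cS _.
  have -> : circle_set = (fun z : R[i]^o => `|z| : R[i]^o) @^-1` [set 1] by [].
  apply: preimage_closed.
    move=> z _ V /nbhs_ballP[e /= e0 Ve]; apply/nbhs_ballP; exists e => //= w.
    rewrite -ball_normE /= => zw; apply: Ve; rewrite -ball_normE /=.
    exact: le_lt_trans (ler_dist_dist _ _) zw.
  exact/accessible_closed_set1/hausdorff_accessible/norm_hausdorff.
move=> z; rewrite /circle_set /= => z1.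
exists (complex.Re z, complex.Im z); last by case: (z).
have := normc_ge_Re z; have := normc_geIm z; rewrite z1 !lecR.
by rewrite !ler_norml; split; rewrite /= in_itv.
Qed.

HB.instance Definition _ :=
  isCompactSpace.Build circle (compact_set_type circle_set_compact).

Definition unit_interval : Type := set_type `[(0 : R), 1].
HB.instance Definition _ := Topological.on unit_interval.
HB.instance Definition _ :=
  isCompactSpace.Build unit_interval
    (compact_set_type (@segment_compact R 0 1)).
End circle.

Arguments circle_set : clear implicits.

Definition unital_star_hom (R : realType) (A B : cstarAlgType R)
    (f : A -> B) : Prop :=
  [/\ forall (c : R[i]) (x y : A), f (c *: x + y) = c *: f x + f y,
      forall x y : A, f (x * y) = f x * f y,
      f 1 = 1 &
      forall x : A, f (star x) = star (f x)].

Record cstar_action (R : realType) (G : finZmodType) (A : cstarAlgType R) :=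
  CStarAction {
    act :> G -> A -> A;
    act_hom : forall g, unital_star_hom (act g);
    act0 : forall a, act 0 a = a;
    actD : forall g h a, act (g + h) a = act g (act h a)
  }.

Definition commuting_actions (R : realType) (G : finZmodType)
    (A : cstarAlgType R) (alpha beta : cstar_action G A) : Prop :=
  forall g h a, alpha g (beta h a) = beta h (alpha g a).

Definition is_character (R : realType) (G : finZmodType) (gamma : G -> R[i]) :
    Prop :=
  (forall g, `|gamma g| = 1) /\
  (forall g h, gamma (g + h) = gamma g * gamma h).

Definition spectral_subspace (R : realType) (G : finZmodType)
    (A : cstarAlgType R) (alpha : cstar_action G A) (gamma : G -> R[i]) :
    set A :=
  [set a | forall g, alpha g a = gamma g *: a].

Definition linear_span (R : realType) (A : cstarAlgType R) (S : set A) :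
    set A :=
  [set x | exists (n : nat) (c : 'I_n -> R[i]) (s : 'I_n -> A),
     (forall i, S (s i)) /\ x = \sum_(i < n) c i *: s i].

Definition free_action (R : realType) (G : finZmodType) (A : cstarAlgType R)
    (alpha : cstar_action G A) : Prop :=
  forall gamma : G -> R[i], is_character gamma ->
    let Ag := spectral_subspace alpha gamma in
    closure (linear_span [set x | exists a b : A,
      [/\ Ag a, Ag b & x = a * star b]]) 1.

Lemma unit_interval0_subproof (R : realType) :
  0 \in [set` `[(0 : R), 1]].
Proof. by apply/mem_set; rewrite /= in_itv /= lexx ler01. Qed.

Lemma unit_interval1_subproof (R : realType) :
  1 \in [set` `[(0 : R), 1]].
Proof. by apply/mem_set; rewrite /= in_itv /= lexx ler01. Qed.

Definition unit_interval0 (R : realType) : unit_interval R :=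
  exist (fun t : R => t \in [set` `[(0 : R), 1]]) 0
    (unit_interval0_subproof R).
Definition unit_interval1 (R : realType) : unit_interval R :=
  exist (fun t : R => t \in [set` `[(0 : R), 1]]) 1
    (unit_interval1_subproof R).

Section crossed_product.
Variables (R : realType) (k : nat) (A : cstarAlgType R).
Variable beta : cstar_action 'Z_k A.

(* A realization of the crossed product of [A] by [beta]: a C^*-algebra that
   contains [A] and a unitary [cp_unit] generating a copy of Z/k implementing
   [beta], with unique expansions.  It is determined up to isomorphism.
   ['Z_k] is Z/k only for [1 < k], assumed wherever [k] is quantified. *)
Record crossed_product := CrossedProduct {
  cp_alg :> cstarAlgType R;
  cp_inj : A -> cp_alg;
  cp_unit : cp_alg;
  cp_inj_hom : unital_star_hom cp_inj;
  cp_inj_isometry : forall a, `|cp_inj a| = `|a|;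
  cp_unitaryl : star cp_unit * cp_unit = 1;
  cp_unitaryr : cp_unit * star cp_unit = 1;
  cp_unitX : cp_unit ^+ k = 1;
  cp_implement : forall a,
    cp_unit * cp_inj a * star cp_unit = cp_inj (beta 1 a);
  cp_expand : forall x : cp_alg, exists! a : {ffun 'Z_k -> A},
    x = \sum_j cp_inj (a j) * cp_unit ^+ j
}.

Variable P : crossed_product.

Definition cp_coef (x : P) : {ffun 'Z_k -> A} :=
  sval (cid (cp_expand x)).

Lemma cp_coefP (x : P) :
  x = \sum_j cp_inj P (cp_coef x j) * cp_unit P ^+ j.
Proof. by rewrite {1}(svalP (cid (cp_expand x))).1. Qed.

Lemma cp_coef_sum (a : {ffun 'Z_k -> A}) :
  cp_coef (\sum_j cp_inj P (a j) * cp_unit P ^+ j) = a.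
Proof. by apply: (svalP (cid (cp_expand _))).2. Qed.

Definition root_unity : R[i] :=
  (cos (2 * pi / k%:R) +i* sin (2 * pi / k%:R))%C.

(* The automorphism sum_j a_j mu^j |-> sum_j omega^j alpha(a_j) mu^j. *)
Definition cp_twist (alpha : cstar_action 'Z_k A) (x : P) : P :=
  \sum_(j : 'Z_k)
    (root_unity ^+ j *: cp_inj P (alpha 1 (cp_coef x j))) * cp_unit P ^+ j.

Definition cp_dual (alpha : cstar_action 'Z_k A) (g : 'Z_k) : P -> P :=
  iter g (cp_twist alpha).

(* C^*(Gamma) inside the crossed product: the C^*-algebra generated by the group
   of unitaries mu^j. *)
Definition group_cstar : set P :=
  closure (linear_span [set u | exists j : 'Z_k, u = cp_unit P ^+ j]).

Definition twisted_join : set (cont_fun (unit_interval R) P) :=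
  [set f | group_cstar (f (unit_interval0 R)) /\
           range (cp_inj P) (f (unit_interval1 R))].

(* The action alpha~ on the twisted join.  Taking values in plain functions
   avoids a proof that [cp_dual alpha g] is continuous; for [f] in the join,
   [cp_dual alpha g \o f] is again in the join. *)
Definition join_action (alpha : cstar_action 'Z_k A) (g : 'Z_k)
    (f : unit_interval R -> P) : unit_interval R -> P :=
  cp_dual alpha g \o f.

End crossed_product.

Definition equivariant (G X Y : Type) (sigma : G -> X -> X)
    (tau : G -> Y -> Y) (phi : X -> Y) : Prop :=
  forall g x, phi (sigma g x) = tau g (phi x).

Definition equivariant_hom_to_join (R : realType) (k : nat)
    (A : cstarAlgType R) (alpha beta : cstar_action 'Z_k A)
    (P : crossed_product beta) (phi : A -> cont_fun (unit_interval R) P) :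
    Prop :=
  [/\ unital_star_hom phi,
      forall a, twisted_join (phi a) &
      equivariant alpha (join_action alpha) (fun a => phi a : _ -> P)].

Section involution_action.
Variables (R : realType) (X : compactSpaceType) (s : X -> X).
Hypotheses (sc : continuous s) (sK : involutive s).

Let iter_cont n (f : cont_fun X (cplx R)) :
  continuous (fun x => f (iter n s x)).
Proof.
elim: n => [|n IHn] x; first exact: cf_cont.
have -> : (fun x => f (iter n.+1 s x)) = (fun x => f (iter n s x)) \o s.
  by apply/funext => y; rewrite /= -iterSr.
by apply: continuous_comp; [exact: sc|exact: IHn].
Qed.

(* The action of Z/2 generated by f |-> f \o s. *)
Definition involution_act (g : 'Z_2) (f : cont_fun X (cplx R)) :
    cont_fun X (cplx R) :=
  mkcf (@iter_cont g f).

Let act_hom g : unital_star_hom (involution_act g).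
Proof. by split => [c x y|x y||x]; apply: cf_ext. Qed.

Let act0 f : involution_act 0 f = f.
Proof. exact: cf_ext. Qed.

Let actD g h f :
  involution_act (g + h) f = involution_act g (involution_act h f).
Proof.
apply: cf_ext => x; congr (cf_fun f _).
have sKx n : iter (n %% 2) s x = iter n s x.
  rewrite [in RHS](divn_eq n 2) iterD iterM.
  suff -> m : forall y, iter m (iter 2 s) y = y by [].
  by elim: m => //= m IHm y; rewrite IHm sK.
by rewrite /= sKx addnC iterD.
Qed.

Definition involution_action : cstar_action 'Z_2 (cont_fun X (cplx R)) :=
  CStarAction act_hom act0 actD.

End involution_action.

Section circle_actions.
Variable R : realType.

Let antipode_subproof (w : circle R) : - (set_val w : R[i]^o) \in circle_set R.
Proof.
apply/mem_set; rewrite /circle_set /= normrN.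
exact: (set_valP w).
Qed.

Definition antipode (w : circle R) : circle R :=
  exist (fun z => z \in circle_set R) (- (set_val w : R[i]^o))
    (antipode_subproof w).

Let circle_conj_subproof (w : circle R) :
  ((set_val w : R[i])^* : R[i]^o) \in circle_set R.
Proof.
apply/mem_set; rewrite /circle_set /= norm_conjC.
exact: (set_valP w).
Qed.

Definition circle_conj (w : circle R) : circle R :=
  exist (fun z => z \in circle_set R) ((set_val w : R[i])^* : R[i]^o)
    (circle_conj_subproof w).

Lemma antipodeK : involutive antipode.
Proof. by move=> w; apply: val_inj; rewrite /= opprK. Qed.

Lemma circle_conjK : involutive circle_conj.
Proof. by move=> w; apply: val_inj; rewrite /= conjCK. Qed.

Let set_val_continuous : continuous (set_val : circle R -> R[i]^o).
Proof. exact: initial_continuous. Qed.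

Let to_circle_continuous (s : circle R -> circle R) :
  continuous (set_val \o s : circle R -> R[i]^o) -> continuous s.
Proof.
move=> sc w V [_ [[W oW <-] /= Ww] WV].
exact: (@filterS _ _ (nbhs_filter w) _ _ (fun v => WV (s v))
  (sc w W (open_nbhs_nbhs (conj oW Ww)))).
Qed.

Lemma antipode_continuous : continuous antipode.
Proof.
apply: to_circle_continuous => w.
exact: (@cvgN _ (cplx R) _ _ _ _ _ (@set_val_continuous w)).
Qed.

Lemma circle_conj_continuous : continuous circle_conj.
Proof.
apply: to_circle_continuous => w.
apply: (@continuous_comp _ _ _ _ (@star R (cplx R))).
  exact: set_val_continuous.
exact: star_continuous.
Qed.

Definition circle_coord : cont_fun (circle R) (cplx R) :=
  mkcf (set_val_continuous : continuous (_ : circle R -> cplx R)).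

Definition antipodal_action :
    cstar_action 'Z_2 (cont_fun (circle R) (cplx R)) :=
  involution_action R antipode_continuous antipodeK.

Definition conjugation_action :
    cstar_action 'Z_2 (cont_fun (circle R) (cplx R)) :=
  involution_action R circle_conj_continuous circle_conjK.

Lemma antipodal_action_coord :
  antipodal_action 1 circle_coord = - circle_coord.
Proof. exact: cf_ext. Qed.

Lemma conjugation_action_coord :
  conjugation_action 1 circle_coord = star circle_coord.
Proof. exact: cf_ext. Qed.

End circle_actions.

(* Main.v *)
Require Import Defs.
From HB Require Import structures.
From mathcomp Require Import all_boot all_order all_algebra.
From mathcomp Require Import complex.
From mathcomp Require Import all_classical all_reals all_analysis.
From mathcomp Require Import ring lra.

(** In the crossed product of C(S^1) by conjugation, mu z = z^* mu.  Therefore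
    u_t = t z + i sqrt (1 - t^2) mu satisfies u_t u_t^* = 1, the cross terms
    i t sqrt (1 - t^2) (mu z^* - z mu) being 0.  So t |-> u_t is a path of
    unitaries from i mu, in C^*(Z/2), to z, in C(S^1), and u_t is negated by the
    dual action, because its first coefficient is odd and its second one even
    under the antipode.  As C(S^1) is universal for one unitary, f |-> f(u_t) is
    the equivariant homomorphism that is sought.

    The functional calculus of u_t is written out instead of being quoted.  With
    z = x + i y, the real part of u_t is t x, which is central, and its imaginary
    part t y + sqrt (1 - t^2) mu squares to r^2 = 1 - (t x)^2.  So
    u_t = t x + i r H with H a symmetry, and a function f with even and odd parts
    a and b under conjugation is sent to a(w) + b(w) H, where w = t x + i r.  The
    two coefficients of this expression are [join_fun0] and [join_fun1].  They
    are continuous although H is not defined where r = 0, since w is then real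
    and b vanishes at w ([continuous_bounded_mul]); [continuous_into_cont_fun]
    turns their joint continuity in t and z into continuity for the sup norm.
    Multiplicativity, compatibility with star, the values at the end points and
    equivariance are then pointwise identities ([join_map_hom],
    [join_map_join], [join_map_equivariant]), valid in every realization of the
    crossed product.

    A realization exists ([involution_crossed_product]): for an involution s of a
    compact space X, the pairs (f, g) of functions on X, read as f + g mu, form a
    C^*-algebra for the norm of the regular representation, a supremum of
    operator norms of 2 x 2 matrices.

    The antipodal action is free because 1 and z are unitaries in its two
    spectral subspaces.  Conjugation is not: the functions that it negates vanish
    at its fixed point 1. *)

Import Order.TTheory GRing.Theory Num.Theory.
Import numFieldNormedType.Exports.

Local Open Scope classical_set_scope.
Local Open Scope ring_scope.

Set Implicit Arguments.
Unset Strict Implicit.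
Unset Printing Implicit Defensive.

(** * The Hermitian plane *)

Section hermitian_plane.
Variable C : numClosedFieldType.
Implicit Types (a b c d : C) (v w : C * C).

Definition norm2 v : C := sqrtC (`|v.1| ^+ 2 + `|v.2| ^+ 2).

Lemma norm2_ge0 v : 0 <= norm2 v.
Proof. by rewrite sqrtC_ge0 addr_ge0 // exprn_ge0. Qed.

Lemma sqr_norm2 v : norm2 v ^+ 2 = `|v.1| ^+ 2 + `|v.2| ^+ 2.
Proof. exact: sqrtCK. Qed.

Lemma ler_sqr_nneg a b : 0 <= a -> 0 <= b -> a ^+ 2 <= b ^+ 2 -> a <= b.
Proof. by move=> a0 b0; rewrite ler_pXn2r. Qed.

Lemma norm2_le v a : 0 <= a -> `|v.1| ^+ 2 + `|v.2| ^+ 2 <= a ^+ 2 ->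
  norm2 v <= a.
Proof.
by move=> a0; rewrite -sqr_norm2; apply: ler_sqr_nneg => //; exact: norm2_ge0.
Qed.

(** Lagrange's identity: the difference of the squares of the two sides is
    (ad - bc)^2, for the moduli a, b of v and c, d of w. *)
Lemma norm2_CauchySchwarz v w :
  `|v.1| * `|w.1| + `|v.2| * `|w.2| <= norm2 v * norm2 w.
Proof.
apply: ler_sqr_nneg; rewrite ?addr_ge0 ?mulr_ge0 ?norm2_ge0 //.
rewrite exprMn !sqr_norm2 -subr_ge0.
set a := `|v.1|; set b := `|v.2|; set c := `|w.1|; set d := `|w.2|.
have -> : (a ^+ 2 + b ^+ 2) * (c ^+ 2 + d ^+ 2) - (a * c + b * d) ^+ 2 =
  (a * d - b * c) ^+ 2 by ring.
by apply: real_exprn_even_ge0 => //; apply: rpredB; apply: ger0_real;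
  rewrite mulr_ge0 ?normr_ge0.
Qed.

Lemma norm2_triangle v w : norm2 (v.1 + w.1, v.2 + w.2) <= norm2 v + norm2 w.
Proof.
apply: norm2_le => /=; first by rewrite addr_ge0 // norm2_ge0.
have sqrD (x y : C) : `|x + y| ^+ 2 <= (`|x| + `|y|) ^+ 2.
  by rewrite lerXn2r ?nnegrE ?addr_ge0 // ler_normD.
apply: (le_trans (lerD (sqrD _ _) (sqrD _ _))).
rewrite !sqrrD !sqr_norm2 -subr_ge0.
set q := (X in 0 <= X).
have -> : q = (norm2 v * norm2 w - (`|v.1| * `|w.1| + `|v.2| * `|w.2|)) *+ 2.
  by rewrite /q; ring.
by rewrite mulrn_wge0 // subr_ge0 norm2_CauchySchwarz.
Qed.

Lemma norm2Z a v : norm2 (a * v.1, a * v.2) = `|a| * norm2 v.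
Proof.
by rewrite /norm2 /= !normrM !exprMn -mulrDr sqrtCM ?nnegrE ?exprn_ge0
  ?addr_ge0 ?exprn_ge0 // exprCK.
Qed.

Lemma norm2_leM v w a : 0 <= a ->
  `|v.1| <= a * `|w.1| -> `|v.2| <= a * `|w.2| -> norm2 v <= a * norm2 w.
Proof.
move=> a0 v1 v2; apply: norm2_le; first by rewrite mulr_ge0 ?norm2_ge0.
rewrite exprMn sqr_norm2 mulrDr -!exprMn.
by rewrite lerD // lerXn2r // nnegrE mulr_ge0.
Qed.

Lemma norm2_swap v : norm2 (v.2, v.1) = norm2 v.
Proof. by rewrite /norm2 /= addrC. Qed.

Lemma norm2_ge1 v : `|v.1| <= norm2 v.
Proof.
apply: ler_sqr_nneg; rewrite ?norm2_ge0 // sqr_norm2.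
by rewrite lerDl exprn_ge0.
Qed.

Lemma norm2_eq0 v : norm2 v = 0 -> v = (0, 0).
Proof.
move=> v0; have := norm2_ge1 v; rewrite v0 normr_le0 => /eqP v10.
have := norm2_ge1 (v.2, v.1); rewrite norm2_swap v0 normr_le0 => /eqP v20.
by case: v v10 v20 {v0} => ? ? /= -> ->.
Qed.

Lemma norm2_dot v w : `|v.1^* * w.1 + v.2^* * w.2| <= norm2 v * norm2 w.
Proof.
rewrite (le_trans _ (norm2_CauchySchwarz _ _)) //.
by rewrite (le_trans (ler_normD _ _)) // !normrM !norm_conjC.
Qed.

Lemma norm2_10 : norm2 (1, 0) = 1.
Proof. by rewrite /norm2 /= normr1 normr0 expr0n addr0 expr1n sqrtC1. Qed.

End hermitian_plane.

(** * The crossed product of C(X) by an involution *)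

Section scalar_functions.
Variables (R : realType) (X : compactSpaceType).
Local Notation C := R[i].
Implicit Types f g : cont_fun X (cplx R).

(* [cf_fun] is spelled out because the sum, scaling and star live in structures
   whose own coercion to functions would be used instead. *)
Lemma cf_addE f g x : cf_fun (f + g) x = (f x : C) + (g x : C) :> C.
Proof. by []. Qed.
Lemma cf_mulE f g x : cf_fun (cf_mul f g) x = (f x : C) * (g x : C) :> C.
Proof. by []. Qed.
Lemma cf_scaleE (c : C) f x : cf_fun (c *: f) x = c * (f x : C) :> C.
Proof. by []. Qed.
Lemma cf_starE f x : cf_fun (star f) x = (f x : C)^* :> C.
Proof. by []. Qed.
Lemma cf_zeroE x : cf_fun (0 : cont_fun X (cplx R)) x = 0 :> C.
Proof. by []. Qed.
Lemma cf_oneE x : cf_fun (cf_one X (cplx R)) x = 1 :> C.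
Proof. by []. Qed.
Definition cfE :=
  (cf_addE, cf_mulE, cf_scaleE, cf_starE, cf_zeroE, cf_oneE).

End scalar_functions.

Section involution_crossed_product.
Variables (R : realType) (X : compactSpaceType) (s : X -> X).
Hypotheses (sc : continuous s) (sK : involutive s).
Local Notation cf := (cont_fun X (cplx R)).
Local Notation C := R[i].

Let comp_continuous (f : cf) : continuous (fun x => f (s x)).
Proof. by move=> x; apply: continuous_comp; [exact: sc|exact: cf_cont]. Qed.

Definition cf_comp (f : cf) : cf := mkcf (@comp_continuous f).

Lemma cf_compE (f : cf) x : cf_comp f x = f (s x).
Proof. by []. Qed.

Lemma ler_norm_cf (f : cf) x : `|f x : C| <= `|f|.
Proof. exact: (cf_norm_ge f x). Qed.

(** The pair (f, g) stands for f + g mu.  The two hypotheses on [s] are phantom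
    arguments: they keep the twisted structures below apart from those of the
    product type. *)
Definition involution_cp (_ : continuous s) (_ : involutive s) : Type :=
  (cf * cf)%type.
Local Notation cp := (involution_cp sc sK).

HB.instance Definition _ := GRing.Lmodule.copy cp (cf * cf)%type.
Implicit Types (p q : cp) (v w : C * C) (x : X).

(** Multiplication, unit and involution are forced by mu f = (f o s) mu and
    mu = mu^* = mu^-1. *)
Definition icp_mul p q : cp :=
  (cf_mul p.1 q.1 + cf_mul p.2 (cf_comp q.2),
   cf_mul p.1 q.2 + cf_mul p.2 (cf_comp q.1)).
Definition icp_one : cp := (cf_one _ _, 0).
Definition icp_star p : cp := (star p.1, star (cf_comp p.2)).

(** The fibre at x of the regular representation of C(X) x| Z/2: the matrix with
    rows (f x, g x) and (g (s x), f (s x)), acting on C^2. *)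
Definition icp_rep p x v : C * C :=
  ((p.1 x : C) * v.1 + (p.2 x : C) * v.2,
   (p.2 (s x) : C) * v.1 + (p.1 (s x) : C) * v.2).

Lemma icp_ext p q : (forall x, p.1 x = q.1 x :> C) ->
  (forall x, p.2 x = q.2 x :> C) -> p = q.
Proof.
by case: p q => [p1 p2] [q1 q2] /= e1 e2; congr pair; apply: cf_ext.
Qed.

Lemma icp_repM p q x v :
  icp_rep (icp_mul p q) x v = icp_rep p x (icp_rep q x v).
Proof.
have E (f g h l : cf) y :
  (cf_mul f g + cf_mul h l) y = f y * g y + h y * l y :> C by [].
by rewrite /icp_rep /=; congr pair; rewrite !E !cf_compE ?sK; ring.
Qed.

Lemma icp_repD p q x v : icp_rep (p + q) x v =
  ((icp_rep p x v).1 + (icp_rep q x v).1,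
   (icp_rep p x v).2 + (icp_rep q x v).2).
Proof.
have E (f g : cf) y : (f + g) y = f y + g y :> C by [].
by rewrite /icp_rep /=; congr pair; rewrite !E; ring.
Qed.

Lemma icp_repZ (c : C) p x v : icp_rep (c *: p) x v =
  (c * (icp_rep p x v).1, c * (icp_rep p x v).2).
Proof.
have E (f : cf) y : (c *: f) y = c * f y :> C by [].
by rewrite /icp_rep /=; congr pair; rewrite !E; ring.
Qed.

(** The fibre representations are *-preserving: the fibre of the star is the
    adjoint matrix. *)
Lemma icp_rep_star p x v w :
  (icp_rep p x v).1^* * w.1 + (icp_rep p x v).2^* * w.2 =
  v.1^* * (icp_rep (icp_star p) x w).1 + v.2^* * (icp_rep (icp_star p) x w).2.
Proof.
have E (f : cf) y : star f y = (f y : C)^* :> C by [].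
by rewrite /icp_rep /= !E !cf_compE !sK !rmorphD !rmorphM /=; ring.
Qed.

Lemma icp_repZv p x (c : C) v : icp_rep p x (c * v.1, c * v.2) =
  (c * (icp_rep p x v).1, c * (icp_rep p x v).2).
Proof. by rewrite /icp_rep /=; congr pair; ring. Qed.

Lemma icp_rep_le p x v : norm2 (icp_rep p x v) <= (`|p.1| + `|p.2|) * norm2 v.
Proof.
rewrite mulrDl.
pose v1 : C * C := ((p.1 x : C) * v.1, (p.1 (s x) : C) * v.2).
pose v2 : C * C := ((p.2 x : C) * v.2, (p.2 (s x) : C) * v.1).
have -> : icp_rep p x v = (v1.1 + v2.1, v1.2 + v2.2).
  by rewrite /icp_rep /=; congr pair; rewrite addrC.
apply: (le_trans (norm2_triangle _ _)); apply: lerD.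
  by apply: norm2_leM => //=; rewrite normrM ler_wpM2r // ler_norm_cf.
rewrite -(norm2_swap v).
by apply: norm2_leM => //=; rewrite normrM ler_wpM2r // ler_norm_cf.
Qed.

(** The supremum over x of the operator norms of the fibre matrices.  By
    [icp_norm_ge] and [icp_norm_le] it is the least uniform bound. *)
Definition icp_norm p : C :=
  (sup [set complex.Re (norm2 (icp_rep p a.1 a.2)) |
    a in [set a : X * (C * C) | norm2 a.2 <= 1]])%:C%C.

Lemma icp_norm_ge p x v : norm2 (icp_rep p x v) <= icp_norm p * norm2 v.
Proof.
have ub w : norm2 w <= 1 -> norm2 (icp_rep p x w) <= icp_norm p.
  move=> w1; rewrite -[leLHS]ge0_ReE ?norm2_ge0 // lecR.
  apply: ub_le_sup; last by exists (x, w).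
  have M0 : 0 <= `|p.1| + `|p.2| by rewrite addr_ge0.
  have := icp_rep_le p; move: (`|p.1| + `|p.2|) M0 => M M0 pM.
  exists (complex.Re M) => _ [[y u] /= u1 <-].
  rewrite -lecR !ge0_ReE ?norm2_ge0 //.
  by apply: (le_trans (pM _ _)); rewrite ler_piMr.
have [v0|v0] := eqVneq (norm2 v) 0.
  rewrite v0 mulr0 (norm2_eq0 v0) /icp_rep /= !mulr0 addr0.
  by rewrite /norm2 /= normr0 expr0n addr0 sqrtC0.
have v_gt0 : 0 < norm2 v by rewrite lt_def v0 norm2_ge0.
rewrite -ler_pdivrMr // mulrC.
have vV : `|(norm2 v)^-1| = (norm2 v)^-1 by rewrite ger0_norm // invr_ge0 ltW.
rewrite -{1}vV -norm2Z -icp_repZv ub // norm2Z vV mulVf //.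
Qed.

Lemma icp_norm_le p (M : C) : 0 <= M ->
  (forall x v, norm2 (icp_rep p x v) <= M * norm2 v) -> icp_norm p <= M.
Proof.
move=> M0 pM.
have ME : M = (complex.Re M)%:C%C by rewrite ge0_ReE.
rewrite /icp_norm ME lecR.
have [[x _]|/set0P/negP/negPn/eqP X0] := pselect ([set: X] !=set0).
  apply: ge_sup.
    exists (complex.Re (norm2 (icp_rep p x (0, 0)))), (x, (0, 0)) => //=.
    by rewrite /norm2 /= normr0 expr0n addr0 sqrtC0 ler01.
  move=> _ [[y v] /= v1 <-]; rewrite -lecR ge0_ReE ?norm2_ge0 // -ME.
  by apply: (le_trans (pM _ _)); rewrite ler_piMr.
rewrite (_ : [set _ | _ in _] = set0) ?sup0; first by rewrite -lecR -ME.
apply/seteqP; split => // t [[y v] _ _].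
by have : [set: X] y by []; rewrite X0.
Qed.

Lemma icp_norm_ge0 p : 0 <= icp_norm p.
Proof.
have [[x _]|/set0P/negP/negPn/eqP X0] := pselect ([set: X] !=set0).
  have := icp_norm_ge p x (1, 0); rewrite norm2_10 mulr1.
  exact: le_trans (norm2_ge0 _).
rewrite /icp_norm (_ : [set _ | _ in _] = set0) ?sup0 //.
apply/seteqP; split => // t [[y v] _ _].
by have : [set: X] y by []; rewrite X0.
Qed.

(** This bound and the next two make the norm equivalent to the maximum of the
    sup norms of the components, from which completeness is inherited. *)
Lemma icp_norm_leD p : icp_norm p <= `|p.1| + `|p.2|.
Proof. by apply: icp_norm_le; [rewrite addr_ge0|exact: icp_rep_le]. Qed.

Lemma icp_norm_ge_fst p : `|p.1| <= icp_norm p.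
Proof.
apply: cf_norm_le => [|x]; first exact: icp_norm_ge0.
have := le_trans (norm2_ge1 _) (icp_norm_ge p x (1, 0)).
by rewrite norm2_10 /= !mulr1 mulr0 addr0.
Qed.

Lemma icp_norm_ge_snd p : `|p.2| <= icp_norm p.
Proof.
apply: cf_norm_le => [|x]; first exact: icp_norm_ge0.
have := le_trans (norm2_ge1 _) (icp_norm_ge p x (0, 1)).
by rewrite (norm2_swap (1, 0)) norm2_10 /= !mulr1 mulr0 add0r.
Qed.

Let norm_triangle p q : icp_norm (p + q) <= icp_norm p + icp_norm q.
Proof.
apply: icp_norm_le => [|x v]; first by rewrite addr_ge0 // icp_norm_ge0.
rewrite icp_repD mulrDl (le_trans (norm2_triangle _ _)) //.
by rewrite lerD // icp_norm_ge.
Qed.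

Let norm_eq0 p : icp_norm p = 0 -> p = 0.
Proof.
move=> p0; have := icp_norm_ge_fst p; have := icp_norm_ge_snd p.
rewrite p0 !normr_le0 => /eqP p2 /eqP p1.
by case: p p1 p2 {p0} => ? ? /= -> ->.
Qed.

Let norm_scale (c : C) p : icp_norm (c *: p) = `|c| * icp_norm p.
Proof.
have le_sc (d : C) q : icp_norm (d *: q) <= `|d| * icp_norm q.
  apply: icp_norm_le => [|x v]; first by rewrite mulr_ge0 // icp_norm_ge0.
  by rewrite icp_repZ norm2Z -mulrA ler_wpM2l // icp_norm_ge.
apply/eqP; rewrite eq_le le_sc /=.
have [->|c0] := eqVneq c 0; first by rewrite normr0 mul0r icp_norm_ge0.
rewrite -ler_pdivlMl ?normr_gt0 // -normfV -{1}[p](scalerK c0).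
exact: le_sc.
Qed.

HB.instance Definition _ :=
  Lmodule_isNormed.Build R[i] cp norm_triangle norm_scale norm_eq0.

Let icp_complete (F : set_system cp) : ProperFilter F -> cauchy F -> cvg F.
Proof.
move=> FF Fc.
have Fb (e : R[i]) : 0 < e -> exists p : cp, F (ball p e).
  by move=> e0; have /cauchyP := Fc; apply.
have c1 : cvg ((fun p : cp => p.1 : cf) @ F).
  apply: cauchy_cvg; apply/cauchyP => e /Fb[p Fp]; exists p.1.
  rewrite /nbhs /=; apply: filterS Fp => q.
  rewrite -!ball_normE /ball_ /=; apply: le_lt_trans.
  exact: (icp_norm_ge_fst (p - q)).
have c2 : cvg ((fun p : cp => p.2 : cf) @ F).
  apply: cauchy_cvg; apply/cauchyP => e /Fb[p Fp]; exists p.2.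
  rewrite /nbhs /=; apply: filterS Fp => q.
  rewrite -!ball_normE /ball_ /=; apply: le_lt_trans.
  exact: (icp_norm_ge_snd (p - q)).
set l1 := lim _ in c1; set l2 := lim _ in c2.
apply/cvg_ex; exists ((l1, l2) : cp).
move=> V /nbhs_ballP[e /= e0 Ve].
have e20 : 0 < e / 2 by rewrite divr_gt0.
have F1 : F [set q : cp | `|l1 - q.1| < e / 2].
  by have := c1 _ (nbhsx_ballx l1 _ e20); rewrite /nbhs /= -ball_normE.
have F2 : F [set q : cp | `|l2 - q.2| < e / 2].
  by have := c2 _ (nbhsx_ballx l2 _ e20); rewrite /nbhs /= -ball_normE.
rewrite /nbhs /=; apply: filterS (filterI F1 F2) => q [/= q1 q2].
apply: Ve; rewrite -ball_normE /=.
apply: (le_lt_trans (icp_norm_leD _)).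
by rewrite [ltRHS]splitr ltrD.
Qed.

HB.instance Definition _ := Uniform_isComplete.Build cp icp_complete.

Lemma icp_add1 p q : (p + q).1 = p.1 + q.1. Proof. by []. Qed.
Lemma icp_add2 p q : (p + q).2 = p.2 + q.2. Proof. by []. Qed.
Lemma icp_scale1 (c : C) p : (c *: p).1 = c *: p.1. Proof. by []. Qed.
Lemma icp_scale2 (c : C) p : (c *: p).2 = c *: p.2. Proof. by []. Qed.
Lemma icp_mul1 p q :
  (icp_mul p q).1 = cf_mul p.1 q.1 + cf_mul p.2 (cf_comp q.2).
Proof. by []. Qed.
Lemma icp_mul2 p q :
  (icp_mul p q).2 = cf_mul p.1 q.2 + cf_mul p.2 (cf_comp q.1).
Proof. by []. Qed.
Lemma icp_star1 p : (icp_star p).1 = star p.1. Proof. by []. Qed.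
Lemma icp_star2 p : (icp_star p).2 = star (cf_comp p.2). Proof. by []. Qed.
Lemma icp_one1 : icp_one.1 = cf_one X (cplx R). Proof. by []. Qed.
Lemma icp_one2 : icp_one.2 = 0 :> cf. Proof. by []. Qed.
Definition pointwiseE := (icp_add1, icp_add2, icp_scale1, icp_scale2, icp_mul1,
  icp_mul2, icp_star1, icp_star2, icp_one1, icp_one2, cfE, cf_compE).

Let mulA : associative icp_mul.
Proof.
by move=> p q r; apply: icp_ext => x; rewrite !pointwiseE ?sK; ring.
Qed.
Let mul1 : left_id icp_one icp_mul.
Proof. by move=> p; apply: icp_ext => x; rewrite !pointwiseE; ring. Qed.
Let mulx1 : right_id icp_one icp_mul.
Proof. by move=> p; apply: icp_ext => x; rewrite !pointwiseE; ring. Qed.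
Let mulDl : left_distributive icp_mul +%R.
Proof. by move=> p q r; apply: icp_ext => x; rewrite !pointwiseE; ring. Qed.
Let mulDr : right_distributive icp_mul +%R.
Proof. by move=> p q r; apply: icp_ext => x; rewrite !pointwiseE; ring. Qed.
Let mulAl (c : C) p q : c *: icp_mul p q = icp_mul (c *: p) q.
Proof. by apply: icp_ext => x; rewrite !pointwiseE; ring. Qed.
Let mulAr (c : C) p q : c *: icp_mul p q = icp_mul p (c *: q).
Proof. by apply: icp_ext => x; rewrite !pointwiseE; ring. Qed.
Let cstarK : involutive icp_star.
Proof. by move=> p; apply: icp_ext => x; rewrite !pointwiseE ?sK conjCK. Qed.
Let cstarD : {morph icp_star : p q / p + q}.
Proof. by move=> p q; apply: icp_ext => x; rewrite !pointwiseE rmorphD. Qed.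
Let cstarZ (c : C) p : icp_star (c *: p) = c^* *: icp_star p.
Proof. by apply: icp_ext => x; rewrite !pointwiseE rmorphM. Qed.
Let cstarM p q : icp_star (icp_mul p q) = icp_mul (icp_star q) (icp_star p).
Proof.
by apply: icp_ext => x; rewrite !pointwiseE ?sK rmorphD !rmorphM /=; ring.
Qed.

Let normM p q : icp_norm (icp_mul p q) <= icp_norm p * icp_norm q.
Proof.
have n0 := icp_norm_ge0.
apply: icp_norm_le => [|x v]; first by rewrite mulr_ge0.
rewrite icp_repM (le_trans (icp_norm_ge _ _ _)) // -mulrA.
by rewrite ler_wpM2l // icp_norm_ge.
Qed.

Let norm_star p : icp_norm (icp_mul (icp_star p) p) = icp_norm p ^+ 2.
Proof.
have n0 := icp_norm_ge0.
(* |x v|^2 = <x^* x v, v> <= |x^* x v| |v|, fibre by fibre. *)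
have le_sqr r : icp_norm r ^+ 2 <= icp_norm (icp_mul (icp_star r) r).
  set N := icp_norm (icp_mul _ _); have N0 : 0 <= N by exact: n0.
  rewrite -(sqrtCK N) lerXn2r ?nnegrE ?sqrtC_ge0 //.
  apply: icp_norm_le => [|x v]; first by rewrite sqrtC_ge0.
  apply: ler_sqr_nneg; rewrite ?mulr_ge0 ?norm2_ge0 ?sqrtC_ge0 //.
  rewrite [leLHS]sqr_norm2 exprMn (sqrtCK N) !normCKC icp_rep_star -icp_repM.
  rewrite (le_trans (real_ler_norm _)) //.
    rewrite icp_repM -icp_rep_star -!normCKC.
    by rewrite ger0_real // addr_ge0 ?exprn_ge0.
  rewrite (le_trans (norm2_dot _ _)) //.
  rewrite mulrC expr2 mulrA ler_wpM2r ?norm2_ge0 //.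
  exact: icp_norm_ge.
(* Hence |r|^2 <= |r^*| |r|, and the norm is *-invariant as [star] is an
   involution. *)
have le_star r : icp_norm r <= icp_norm (icp_star r).
  have [->|r0] := eqVneq (icp_norm r) 0; first exact: n0.
  have := le_trans (le_sqr r) (normM (icp_star r) r).
  by rewrite expr2 ler_pM2r // lt_def r0 n0.
have norm_starE : icp_norm (icp_star p) = icp_norm p.
  by apply/eqP; rewrite eq_le le_star andbT -{2}(cstarK p) le_star.
apply/eqP; rewrite eq_le le_sqr andbT.
apply: (le_trans (normM _ _)).
by rewrite [X in X * _]norm_starE -expr2.
Qed.

HB.instance Definition _ :=
  isCStarAlgebra.Build R cp mulA mul1 mulx1 mulDl mulDr mulAl mulAr
    cstarK cstarD cstarZ cstarM normM norm_star.

Definition icp_embed (f : cf) : cp := (f, 0).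
Definition icp_swap : cp := (0, cf_one X (cplx R)).

Lemma icp_embed1 (f : cf) : (icp_embed f).1 = f. Proof. by []. Qed.
Lemma icp_embed2 (f : cf) : (icp_embed f).2 = 0 :> cf. Proof. by []. Qed.
Lemma icp_swap1 : icp_swap.1 = 0 :> cf. Proof. by []. Qed.
Lemma icp_swap2 : icp_swap.2 = cf_one X (cplx R). Proof. by []. Qed.
Let icp_genE := (icp_embed1, icp_embed2, icp_swap1, icp_swap2, pointwiseE).

Let embedP (c : C) (f g : cf) :
  icp_embed (c *: f + g) = c *: icp_embed f + icp_embed g.
Proof. by apply: icp_ext => x; rewrite !icp_genE; ring. Qed.
Let embedM (f g : cf) :
  icp_embed (cf_mul f g) = icp_mul (icp_embed f) (icp_embed g).
Proof. by apply: icp_ext => x; rewrite !icp_genE; ring. Qed.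
Let embed_star (f : cf) : icp_embed (star f) = icp_star (icp_embed f).
Proof.
by apply: icp_ext => x; rewrite !icp_genE ?rmorph0.
Qed.

Lemma icp_embed_hom : unital_star_hom icp_embed.
Proof.
by split; [exact: embedP|exact: embedM| |exact: embed_star].
Qed.

Lemma norm_icp_embed (f : cf) : `|icp_embed f| = `|f|.
Proof.
apply/eqP; rewrite eq_le (icp_norm_ge_fst (icp_embed f)) andbT.
by apply: (le_trans (icp_norm_leD _)); rewrite /= normr0 addr0.
Qed.

Let embed_swap (f g : cf) :
  icp_embed f + icp_mul (icp_embed g) icp_swap = (f, g) :> cp.
Proof.
by apply: icp_ext => x; rewrite !icp_genE /=; ring.
Qed.

Let swap_unitaryl : icp_mul (icp_star icp_swap) icp_swap = icp_one.
Proof.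
apply: icp_ext => x; rewrite !icp_genE ?(rmorph0, rmorph1);
  by ring.
Qed.
Let swap_unitaryr : icp_mul icp_swap (icp_star icp_swap) = icp_one.
Proof.
apply: icp_ext => x; rewrite !icp_genE ?(rmorph0, rmorph1);
  by ring.
Qed.
Let swap_sqr : icp_mul icp_swap icp_swap = icp_one.
Proof.
by apply: icp_ext => x; rewrite !icp_genE; ring.
Qed.
Let swap_implement (f : cf) :
  icp_mul (icp_mul icp_swap (icp_embed f)) (icp_star icp_swap) =
  icp_embed (involution_action R sc sK 1 f).
Proof.
have actE x : cf_fun (involution_action R sc sK 1 f) x = f (s x) :> C by [].
apply: icp_ext => x;
  rewrite !icp_genE ?actE ?(rmorph0, rmorph1); by ring.
Qed.

Local Notation cpA := (cp : cstarAlgType R).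

Let icp_expandE (a : {ffun 'Z_2 -> cf}) :
  \sum_j (icp_embed (a j) : cpA) * (icp_swap : cpA) ^+ j = (a 0, a 1).
Proof.
rewrite big_ord_recl big_ord1 expr0 mulr1 expr1 [LHS]embed_swap.
by congr (a _, a _); apply: val_inj.
Qed.

Let swap_expand (p : cpA) : exists! a : {ffun 'Z_2 -> cf},
  p = \sum_j (icp_embed (a j) : cpA) * (icp_swap : cpA) ^+ j.
Proof.
exists [ffun j : 'Z_2 => if j == 0 then p.1 else p.2]; split.
  by rewrite icp_expandE !ffunE /=; case: (p).
move=> a; rewrite icp_expandE => ->; apply/ffunP => j; rewrite ffunE /=.
by case: j => [[|[|//]] ?] /=; congr (a _); apply: val_inj.
Qed.

Definition involution_crossed_product :
    crossed_product (involution_action R sc sK) :=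
  @CrossedProduct R 2 cf (involution_action R sc sK) cpA _ _
    icp_embed_hom norm_icp_embed swap_unitaryl swap_unitaryr
    swap_sqr swap_implement swap_expand.

End involution_crossed_product.

(** * Crossed products by Z/2 *)

Section star_hom.
Variables (R : realType) (A B : cstarAlgType R) (f : A -> B).
Hypothesis fh : unital_star_hom f.

Lemma star_hom0 : f 0 = 0.
Proof.
case: fh => fl _ _ _; have := fl (-1) 0 0.
by rewrite scaler0 addr0 scaleN1r addNr.
Qed.

Lemma star_homD x y : f (x + y) = f x + f y.
Proof. by case: fh => fl _ _ _; have := fl 1 x y; rewrite !scale1r. Qed.

Lemma star_homZ c x : f (c *: x) = c *: f x.
Proof.
by case: fh => fl _ _ _; have := fl c x 0; rewrite !addr0 star_hom0 addr0.
Qed.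

Lemma star_homB x y : f (x - y) = f x - f y.
Proof. by rewrite star_homD -scaleN1r star_homZ scaleN1r. Qed.

Lemma star_homM x y : f (x * y) = f x * f y. Proof. by case: fh. Qed.
Lemma star_hom1 : f 1 = 1. Proof. by case: fh. Qed.
Lemma star_hom_star x : f (star x) = star (f x). Proof. by case: fh. Qed.

Lemma isometric_star_hom_continuous :
  (forall x, `|f x| = `|x|) -> continuous f.
Proof.
move=> fi z V /nbhs_ballP[e /= e0 Ve]; apply/nbhs_ballP; exists e => //= w.
rewrite -ball_normE /= => zw; apply: Ve; rewrite -ball_normE /=.
by rewrite -star_homB fi.
Qed.

End star_hom.

Section order_two_crossed_product.
Variables (R : realType) (A : cstarAlgType R) (beta : cstar_action 'Z_2 A).
Variable P : crossed_product beta.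
Implicit Types a b c d : A.
Local Notation i := (cp_inj P).
Local Notation mu := (cp_unit P).
Let ih := cp_inj_hom P.

Lemma cp_unit_star : star mu = mu.
Proof.
have mu2 : mu * mu = 1 by rewrite -expr2 (cp_unitX P).
by rewrite -[LHS]mulr1 -mu2 mulrA cp_unitaryl mul1r.
Qed.

Lemma cp_unit_sqr : mu * mu = 1.
Proof. by rewrite -{1}cp_unit_star cp_unitaryl. Qed.

Lemma cp_unit_inj a : mu * i a = i (beta 1 a) * mu.
Proof. by rewrite -cp_implement cp_unit_star -mulrA cp_unit_sqr mulr1. Qed.

Definition cp_pair a b : P := i a + i b * mu.

Lemma cp_pairM a b c d : cp_pair a b * cp_pair c d =
  cp_pair (a * c + b * beta 1 d) (a * d + b * beta 1 c).
Proof.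
have E x y : i x * mu * i y = i x * i (beta 1 y) * mu.
  by rewrite -mulrA cp_unit_inj mulrA.
rewrite /cp_pair !(star_homD ih) !(star_homM ih) !mulrDl !mulrDr.
rewrite E !mulrA E -(mulrA _ mu mu) cp_unit_sqr mulr1.
by rewrite [i b * _ * mu + _]addrC addrACA.
Qed.

Lemma cp_pair_star a b :
  star (cp_pair a b) = cp_pair (star a) (beta 1 (star b)).
Proof.
by rewrite /cp_pair starD starM cp_unit_star -!(star_hom_star ih) cp_unit_inj.
Qed.

Lemma cp_pairD (s : R[i]) a b c d :
  cp_pair (s *: a + c) (s *: b + d) = s *: cp_pair a b + cp_pair c d.
Proof.
rewrite /cp_pair !(star_homD ih) !(star_homZ ih) mulrDl scalerDr.
by rewrite cstar_scalerAl addrACA.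
Qed.

Lemma cp_pair_sum (a : {ffun 'Z_2 -> A}) :
  \sum_j i (a j) * mu ^+ j = cp_pair (a 0) (a 1).
Proof.
rewrite big_ord_recl big_ord1 expr0 mulr1 expr1.
by congr (i (a _) + i (a _) * _); apply: val_inj.
Qed.

Lemma root_unity2 : root_unity R 2 = -1.
Proof.
rewrite /root_unity mulrC mulrA mulVf ?pnatr_eq0 // mul1r cospi sinpi.
by apply/eqP; rewrite eq_complex /= oppr0 !eqxx.
Qed.

Lemma cp_twist_pair (alpha : cstar_action 'Z_2 A) a b :
  cp_twist alpha (cp_pair a b) = cp_pair (alpha 1 a) (- alpha 1 b).
Proof.
have -> : cp_pair a b = \sum_j i ([ffun j : 'Z_2 => if j == 0 then a else b] j)
    * mu ^+ j by rewrite cp_pair_sum !ffunE.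
rewrite /cp_twist cp_coef_sum.
rewrite big_ord_recl big_ord1 !ffunE /= expr0 scale1r mulr1 !expr1 root_unity2.
by rewrite /cp_pair -(scaleN1r (alpha 1 b)) (star_homZ ih).
Qed.

Lemma cp_pair_continuous (T : topologicalType) (F G : T -> A) :
  continuous F -> continuous G -> continuous (fun t => cp_pair (F t) (G t)).
Proof.
move=> Fc Gc t; have ic := isometric_star_hom_continuous ih (cp_inj_isometry P).
apply: cvgD; first by apply: continuous_comp; [exact: Fc|exact: ic].
apply: cstar_cvgM; last exact: cvg_cst.
by apply: continuous_comp; [exact: Gc|exact: ic].
Qed.

Lemma group_cstar_pair (s t : R[i]) :
  group_cstar (cp_pair (s *: (1 : A)) (t *: (1 : A))).
Proof.
apply: subset_closure.
exists 2%N, (fun j => if j == 0 then s else t), (fun j => mu ^+ j); split.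
  by move=> j; exists j.
rewrite big_ord_recl big_ord1 /= expr0 expr1 /cp_pair !(star_homZ ih).
by rewrite (star_hom1 ih) -cstar_scalerAl mul1r.
Qed.

End order_two_crossed_product.

(** * Continuity *)

(** Joint continuity gives continuity for the sup norm by compactness of X: the
    neighbourhoods of t that work near each x have a common one. *)
Lemma continuous_into_cont_fun (R : realType) (X : compactSpaceType)
    (B : cstarAlgType R) (T : topologicalType) (F : T -> cont_fun X B) :
  continuous (fun p : T * X => F p.1 p.2) -> continuous F.
Proof.
move=> Fc t; apply/cvgrPdist_le => e e0.
have FX : \forall t' \near t, forall x, [set: X] x -> `|F t x - F t' x| <= e.
  apply: (iffLR (compact_near_coveringP _) (@compact_space X)) => x _.
  have e20 : 0 < e / 2 by rewrite divr_gt0.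
  have /cvgrPdist_lt/(_ _ e20) [[U V] [/= tU xV] UV] := Fc (t, x).
  exists (V, U) => //= -[y u] [/= Vy Uu].
  have Fty := UV (t, y) (conj (nbhs_singleton tU) Vy).
  have Fuy := UV (u, y) (conj Uu Vy).
  have -> : F t y - F u y = (F t x - F u y) - (F t x - F t y).
    by rewrite opprB [RHS]addrC addrA subrK.
  by rewrite (le_trans (ler_normB _ _)) // [leRHS]splitr lerD // ltW.
near=> t'; apply: cf_norm_le => [|x]; first exact: ltW.
by move: x (I : [set: X] x); near: t'.
Unshelve. all: by end_near. Qed.

Lemma conj_complexE (R : realType) (a b : R) :
  ((a +i* b)%C : R[i])^* = (a +i* - b)%C.
Proof. by []. Qed.

Section complex_valued.
Variables (R : realType) (T : topologicalType).

Lemma continuous_complex (a b : T -> R) t :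
  {for t, continuous a} -> {for t, continuous b} ->
  {for t, continuous (fun u => (a u +i* b u)%C : R[i]^o)}.
Proof.
move=> ac bc; apply/cvgrPdist_lt => e e0.
have eE : e = (complex.Re e)%:C%C by rewrite ge0_ReE // ltW.
have e20 : 0 < complex.Re e / 2.
  by rewrite divr_gt0 //; move: e0; rewrite eE ltcR.
near=> u; rewrite (le_lt_trans (normc_leRI _)) // eE ltcR.
rewrite [ltRHS]splitr !raddfB /= ltrD //; near: u.
  by apply: cvgr_dist_lt => //; exact: ac.
by apply: cvgr_dist_lt => //; exact: bc.
Unshelve. all: by end_near. Qed.

Lemma continuous_into_circle (s : T -> circle R) :
  continuous (fun t => set_val (s t) : R[i]^o) -> continuous s.
Proof.
move=> sc t V [_ [[W oW <-] /= Ws] WV].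
exact: (@filterS _ _ (nbhs_filter t) _ _ (fun u => WV (s u))
  (sc t W (open_nbhs_nbhs (conj oW Ws)))).
Qed.

(** A bounded factor may jump wherever the other factor vanishes. *)
Lemma continuous_bounded_mul (q : T -> R) (g : T -> cplx R) :
  (forall t, `|q t| <= 1) -> continuous g ->
  (forall t, g t <> 0 -> {for t, continuous q}) ->
  continuous (fun t => (q t)%:C%C *: g t : cplx R).
Proof.
move=> q1 gc qc t; have [gt0|/eqP gt0] := eqVneq (g t) 0.
  rewrite /continuous_at gt0 scaler0; apply/cvgrPdist_lt => e e0.
  have /cvgrPdist_lt/(_ _ e0) := gc t; rewrite gt0.
  apply: filterS => u; rewrite !sub0r !normrN normrZ; apply: le_lt_trans.
  rewrite ler_piMl // normc_def /= expr0n addr0 sqrtr_sqr.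
  by rewrite -(rmorph1 (real_complex R)) lecR.
apply: (@cvgZ _ (cplx R) _ _ _ (fun t => (q t)%:C%C) g); last exact: gc.
by apply: continuous_complex; [exact: qc|exact: cvg_cst].
Qed.

End complex_valued.

(** * Coordinates of the path of unitaries *)

Section join_coordinates.
Variable R : realType.
Local Notation I := (unit_interval R).
Local Notation S1 := (circle R).
Implicit Types (t : I) (z : S1).

Definition abscissa z : R := complex.Re (set_val z : R[i]).
Definition ordinate z : R := complex.Im (set_val z : R[i]).

Lemma circle_eq z : abscissa z ^+ 2 + ordinate z ^+ 2 = 1.
Proof.
have : `|set_val z : R[i]| = 1 by exact: (set_valP z).
rewrite normc_def -(rmorph1 (real_complex R)) => /complexI r1.
by rewrite -[LHS]sqr_sqrtr ?addr_ge0 ?sqr_ge0 // [Num.sqrt _]r1 expr1n.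
Qed.

Lemma unit_intervalP t : 0 <= (set_val t : R) <= 1.
Proof. by have := set_valP t; rewrite /= in_itv. Qed.

(** At the point z = x + i y, the real part of the unitary t z + i c mu, where
    c = sqrt (1 - t^2), is the scalar t x, and its imaginary part is the
    self-adjoint element t y + c mu, which squares to (t y)^2 + c^2 =
    1 - (t x)^2.  [join_radius] is the square root of this scalar, and
    [join_point] is the spectral value t x + i r in the upper half circle; the
    other one is its conjugate. *)
Definition join_radius t z : R := Num.sqrt (1 - (set_val t * abscissa z) ^+ 2).

Lemma sqr_join_radius t z :
  join_radius t z ^+ 2 = 1 - (set_val t * abscissa z) ^+ 2.
Proof.
rewrite sqr_sqrtr //; have := circle_eq z; have /andP[t0 t1] := unit_intervalP t.
move: (abscissa z) (ordinate z) (set_val t : R) t0 t1 => x y u u0 u1 xy.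
rewrite exprMn; have : u ^+ 2 <= 1 by rewrite expr_le1.
have := sqr_ge0 y; have := sqr_ge0 x; have := sqr_ge0 u; nra.
Qed.

Lemma sqr_join_radiusE t z : join_radius t z ^+ 2 =
  (set_val t * ordinate z) ^+ 2 + (1 - (set_val t : R) ^+ 2).
Proof.
rewrite sqr_join_radius !exprMn.
by rewrite -[X in _ + (1 - X)]mulr1 -[X in _ + (1 - _ * X)](circle_eq z); ring.
Qed.

Let join_point_subproof t z :
  ((set_val t * abscissa z) +i* join_radius t z)%C \in circle_set R.
Proof.
apply/mem_set; rewrite /circle_set /= normc_def /= sqr_join_radius.
by rewrite addrC subrK sqrtr1.
Qed.

Definition join_point t z : S1 :=
  exist (fun w => w \in circle_set R) _ (join_point_subproof t z).

(** The coefficients of 1 and mu in the symmetry (t y + c mu) / r, which is 1 on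
    the eigenspace of the spectral value t x + i r and -1 on the other.  Where r = 0 both are 0 by the convention on
    division by 0; the formulas of the functional calculus multiply them there by
    a quantity that vanishes. *)
Definition weight0 t z : R := set_val t * ordinate z / join_radius t z.
Definition weight1 t z : R :=
  Num.sqrt (1 - (set_val t : R) ^+ 2) / join_radius t z.

Lemma weight_sqr t z : join_radius t z != 0 ->
  weight0 t z ^+ 2 + weight1 t z ^+ 2 = 1.
Proof.
move=> r0; rewrite /weight0 /weight1 !expr_div_n.
have t2 : 0 <= 1 - (set_val t : R) ^+ 2.
  by have /andP[u0 u1] := unit_intervalP t; rewrite subr_ge0 expr_le1.
rewrite (sqr_sqrtr t2).
by rewrite -mulrDl -sqr_join_radiusE divff // sqrf_eq0.
Qed.

Lemma weight_le1 t z : `|weight0 t z| <= 1 /\ `|weight1 t z| <= 1.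
Proof.
have [r0|/weight_sqr c2] := eqVneq (join_radius t z) 0.
  by rewrite /weight0 /weight1 r0 invr0 !mulr0 normr0.
have sq_le (a : R) : a ^+ 2 <= 1 -> `|a| <= 1.
  by rewrite -real_normK ?num_real // expr_le1.
by split; apply: sq_le; rewrite -c2 ?lerDl ?lerDr sqr_ge0.
Qed.

(** Where the radius vanishes the two spectral values meet. *)
Lemma join_point_conj_eq t z :
  join_radius t z = 0 -> circle_conj (join_point t z) = join_point t z.
Proof. by move=> r0; apply: val_inj; rewrite /= conj_complexE r0 oppr0. Qed.

Local Notation T := (I * S1)%type.

Let t_continuous : continuous (fun u : T => set_val u.1 : R).
Proof.
move=> u; apply: (@continuous_comp _ _ _ fst (set_val : I -> R)).
  exact: cvg_fst.
exact: initial_continuous.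
Qed.

Let z_continuous : continuous (fun u : T => set_val u.2 : R[i]^o).
Proof.
move=> u; apply: (@continuous_comp _ _ _ snd (set_val : S1 -> R[i]^o)).
  exact: cvg_snd.
exact: initial_continuous.
Qed.

Let x_continuous : continuous (fun u : T => abscissa u.2).
Proof.
move=> u; apply: (@continuous_comp _ _ _ (fun u : T => set_val u.2 : R[i]^o)
  (@complex.Re R : R[i]^o -> R)).
  exact: z_continuous.
exact: Re_continuous.
Qed.

Let y_continuous : continuous (fun u : T => ordinate u.2).
Proof.
move=> u; apply: (@continuous_comp _ _ _ (fun u : T => set_val u.2 : R[i]^o)
  (@complex.Im R : R[i]^o -> R)).
  exact: z_continuous.
exact: Im_continuous.
Qed.

Let sqrt1B_continuous (a : T -> R) :
  continuous a -> continuous (fun u => Num.sqrt (1 - a u ^+ 2)).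
Proof.
move=> ac u; apply: (@continuous_comp _ _ _ (fun u => 1 - a u ^+ 2) Num.sqrt).
  apply: cvgB; first exact: cvg_cst.
  apply: (@continuous_comp _ _ _ a (fun b : R => b ^+ 2)); first exact: ac.
  exact: exprn_continuous.
exact: sqrt_continuous.
Qed.

Let r_continuous : continuous (fun u : T => join_radius u.1 u.2).
Proof.
apply: sqrt1B_continuous => u.
by apply: cvgM; [exact: t_continuous|exact: x_continuous].
Qed.

Lemma join_point_continuous : continuous (fun u : T => join_point u.1 u.2).
Proof.
apply: continuous_into_circle => u.
apply: (@continuous_complex _ _ (fun u : T => set_val u.1 * abscissa u.2)
  (fun u : T => join_radius u.1 u.2)).
  by apply: cvgM; [exact: t_continuous|exact: x_continuous].
exact: r_continuous.
Qed.

Lemma weight0_continuous (u : T) : join_radius u.1 u.2 != 0 ->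
  {for u, continuous (fun u : T => weight0 u.1 u.2)}.
Proof.
move=> r0; apply: cvgM; last by apply: cvgV => //; exact: r_continuous.
by apply: cvgM; [exact: t_continuous|exact: y_continuous].
Qed.

Lemma weight1_continuous (u : T) : join_radius u.1 u.2 != 0 ->
  {for u, continuous (fun u : T => weight1 u.1 u.2)}.
Proof.
move=> r0; apply: cvgM; last by apply: cvgV => //; exact: r_continuous.
exact: (sqrt1B_continuous t_continuous).
Qed.

End join_coordinates.

(** * The functional calculus of the path *)

Lemma Z2_cases (g : 'Z_2) : g = 0 \/ g = 1.
Proof. by case: g => [[|[|//]] ?]; [left|right]; exact: val_inj. Qed.

Section join_symmetries.
Variable R : realType.
Implicit Types (t : unit_interval R) (z w : circle R).

Lemma abscissa_conj z : abscissa (circle_conj z) = abscissa z.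
Proof.
have ReJ (c : R[i]) : complex.Re c^* = complex.Re c by case: c.
exact: ReJ.
Qed.

Lemma ordinate_conj z : ordinate (circle_conj z) = - ordinate z.
Proof.
have ImJ (c : R[i]) : complex.Im c^* = - complex.Im c by case: c.
exact: ImJ.
Qed.

Lemma abscissa_antipode z : abscissa (antipode z) = - abscissa z.
Proof. by rewrite /abscissa /= raddfN. Qed.

Lemma ordinate_antipode z : ordinate (antipode z) = - ordinate z.
Proof. by rewrite /ordinate /= raddfN. Qed.

Lemma join_radius_conj t z : join_radius t (circle_conj z) = join_radius t z.
Proof. by rewrite /join_radius abscissa_conj. Qed.

Lemma join_point_conj t z : join_point t (circle_conj z) = join_point t z.
Proof. by apply: val_inj; rewrite /= join_radius_conj abscissa_conj. Qed.

Lemma weight0_conj t z : weight0 t (circle_conj z) = - weight0 t z.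
Proof. by rewrite /weight0 join_radius_conj ordinate_conj mulrN mulNr. Qed.

Lemma weight1_conj t z : weight1 t (circle_conj z) = weight1 t z.
Proof. by rewrite /weight1 join_radius_conj. Qed.

Lemma join_radius_antipode t z :
  join_radius t (antipode z) = join_radius t z.
Proof. by rewrite /join_radius abscissa_antipode mulrN sqrrN. Qed.

Lemma join_point_antipode t z :
  join_point t (antipode z) = antipode (circle_conj (join_point t z)).
Proof.
apply: val_inj; rewrite /= join_radius_antipode abscissa_antipode.
by rewrite mulrN; apply/eqP; rewrite eq_complex /= opprK !eqxx.
Qed.

Lemma weight0_antipode t z : weight0 t (antipode z) = - weight0 t z.
Proof.
by rewrite /weight0 join_radius_antipode ordinate_antipode mulrN mulNr.
Qed.

Lemma weight1_antipode t z : weight1 t (antipode z) = weight1 t z.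
Proof. by rewrite /weight1 join_radius_antipode. Qed.

Lemma circle_conj_antipode z :
  circle_conj (antipode z) = antipode (circle_conj z).
Proof. by apply: val_inj; rewrite /= rmorphN. Qed.

End join_symmetries.

Lemma circle_one_subproof (R : realType) : (1 : R[i]^o) \in circle_set R.
Proof. by apply/mem_set; rewrite /circle_set /= normr1. Qed.

Definition circle_one (R : realType) : circle R :=
  exist (fun w => w \in circle_set R) _ (circle_one_subproof R).

Section join_hom.
Variable R : realType.
Local Notation cf := (cont_fun (circle R) (cplx R)).
Local Notation C := R[i].
Local Notation I := (unit_interval R).
Implicit Types (f g : cf) (t : I) (z w : circle R).

Definition conj_comp f : cf := cf_comp (@circle_conj_continuous R) f.
Definition even_part f : cf := (2^-1 : C) *: (f + conj_comp f).
Definition odd_part f : cf := (2^-1 : C) *: (f - conj_comp f).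

Lemma even_partE f w :
  cf_fun (even_part f) w = ((f w : C) + (f (circle_conj w) : C)) / 2.
Proof. exact: mulrC. Qed.

Lemma odd_partE f w :
  cf_fun (odd_part f) w = ((f w : C) - (f (circle_conj w) : C)) / 2.
Proof. exact: mulrC. Qed.

(** Split f = a + b into its even and odd parts under conjugation.  A unitary
    with spectral values w and its conjugate is Re w + i (Im w) H, where the
    symmetry H is 1 on the eigenspace of w and -1 on the other, so f takes it to
    a(w) + b(w) H.  [join_fun0] and [join_fun1] are the coefficients of 1 and mu
    in this expression. *)
Definition join_fun0 f t z : C :=
  (even_part f (join_point t z) : C) +
  (weight0 t z)%:C%C * (odd_part f (join_point t z) : C).
Definition join_fun1 f t z : C :=
  (weight1 t z)%:C%C * (odd_part f (join_point t z) : C).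

Lemma odd_part_eq0 f t z :
  join_radius t z = 0 -> odd_part f (join_point t z) = 0.
Proof.
by move=> /join_point_conj_eq wE; rewrite [LHS]odd_partE wE subrr mul0r.
Qed.

(** The form in which H^2 = 1 is used: it holds wherever the odd part of f does
    not vanish. *)
Lemma weight_sqr_odd f t z :
  (1 - ((weight0 t z)%:C%C ^+ 2 + (weight1 t z)%:C%C ^+ 2)) *
    (odd_part f (join_point t z) : C) = 0.
Proof.
have [/(odd_part_eq0 f) ->|/weight_sqr c1] := eqVneq (join_radius t z) 0.
  by rewrite mulr0.
by rewrite -!rmorphXn -rmorphD /= c1 rmorph1 subrr mul0r.
Qed.

Let comp_join_point_continuous f :
  continuous (fun u : I * circle R => f (join_point u.1 u.2)).
Proof.
move=> u; apply: (@continuous_comp _ _ _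
  (fun u : I * circle R => join_point u.1 u.2) f).
  exact: join_point_continuous.
exact: cf_cont.
Qed.

(** The weight is bounded, and where it may be discontinuous the radius is 0, so
    that the odd part tends to 0. *)
Lemma join_fun1_continuous f :
  continuous (fun u : I * circle R => join_fun1 f u.1 u.2 : cplx R).
Proof.
apply: (@continuous_bounded_mul _ _ (fun u : I * circle R => weight1 u.1 u.2)
  (fun u => odd_part f (join_point u.1 u.2))) => [u||u fu0].
- exact: (weight_le1 _ _).2.
- exact: comp_join_point_continuous.
- apply: weight1_continuous; apply/eqP => r0; apply: fu0; exact: odd_part_eq0.
Qed.

Lemma join_fun0_continuous f :
  continuous (fun u : I * circle R => join_fun0 f u.1 u.2 : cplx R).
Proof.
move=> v; apply: (@cvgD _ (cplx R)); first exact: comp_join_point_continuous.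
move: v; apply: (@continuous_bounded_mul _ _
  (fun u : I * circle R => weight0 u.1 u.2)
  (fun u => odd_part f (join_point u.1 u.2))) => [u||u fu0].
- exact: (weight_le1 _ _).1.
- exact: comp_join_point_continuous.
- apply: weight0_continuous; apply/eqP => r0; apply: fu0; exact: odd_part_eq0.
Qed.

Let slice_continuous (F : I * circle R -> cplx R) t :
  continuous F -> continuous (fun z => F (t, z)).
Proof.
move=> Fc z; apply: (@continuous_comp _ _ _ (fun z => (t, z)) F).
  move=> V [[U W] /= [tU zW] UV]; apply: filterS zW => z' Wz'.
  by apply: UV; split => //=; exact: nbhs_singleton.
exact: Fc.
Qed.

Definition join_cf0 f t : cf :=
  mkcf (@slice_continuous _ t (@join_fun0_continuous f)).
Definition join_cf1 f t : cf :=
  mkcf (@slice_continuous _ t (@join_fun1_continuous f)).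

Lemma join_cf0E f t z : cf_fun (join_cf0 f t) z = join_fun0 f t z.
Proof. by []. Qed.

Lemma join_cf1E f t z : cf_fun (join_cf1 f t) z = join_fun1 f t z.
Proof. by []. Qed.

Let partE := (even_partE, odd_partE).

Lemma join_fun0_conj f t z : join_fun0 f t (circle_conj z) =
  (even_part f (join_point t z) : C) -
  (weight0 t z)%:C%C * (odd_part f (join_point t z) : C).
Proof.
by rewrite /join_fun0 join_point_conj weight0_conj rmorphN mulNr.
Qed.

Lemma join_fun1_conj f t z : join_fun1 f t (circle_conj z) = join_fun1 f t z.
Proof. by rewrite /join_fun1 join_point_conj weight1_conj. Qed.

Lemma join_fun0P (c : C) f g t z :
  join_fun0 (c *: f + g) t z = c * join_fun0 f t z + join_fun0 g t z.
Proof. by rewrite /join_fun0 !partE !cfE; field. Qed.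

Lemma join_fun1P (c : C) f g t z :
  join_fun1 (c *: f + g) t z = c * join_fun1 f t z + join_fun1 g t z.
Proof. by rewrite /join_fun1 !partE !cfE; field. Qed.

(** The symmetric product (a + b H)(a' + b' H) = (a a' + b b') + (a b' + b a') H
    read off on the coefficient of 1; the two sides differ by a multiple
    of 1 - H^2, which vanishes by [weight_sqr_odd]. *)
Lemma join_fun0M f g t z :
  join_fun0 (cf_mul f g) t z = join_fun0 f t z * join_fun0 g t z +
    join_fun1 f t z * join_fun1 g t (circle_conj z).
Proof.
rewrite join_fun1_conj -[RHS]addr0.
rewrite -(mul0r (odd_part g (join_point t z) : C)) -(weight_sqr_odd f t z).
by rewrite /join_fun0 /join_fun1 !partE !cfE; field.
Qed.

Lemma join_fun1M f g t z :
  join_fun1 (cf_mul f g) t z = join_fun0 f t z * join_fun1 g t z +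
    join_fun1 f t z * join_fun0 g t (circle_conj z).
Proof.
rewrite join_fun0_conj.
by rewrite /join_fun0 /join_fun1 !partE !cfE; field.
Qed.

Let real_conj (a : R) : (a%:C%C : C)^* = a%:C%C.
Proof. by rewrite conj_complexE oppr0. Qed.

Let half_conj : (2^-1 : C)^* = 2^-1.
Proof. by rewrite fmorphV rmorph_nat. Qed.

Lemma even_part_star f w :
  even_part (star f) w = (even_part f w : C)^* :> C.
Proof.
by rewrite !partE !cfE [RHS]rmorphM [X in _ = X * _]rmorphD /= half_conj.
Qed.

Lemma odd_part_star f w : odd_part (star f) w = (odd_part f w : C)^* :> C.
Proof.
by rewrite !partE !cfE [RHS]rmorphM [X in _ = X * _]rmorphB /= half_conj.
Qed.

Lemma join_fun1_star f t z : join_fun1 (star f) t z = (join_fun1 f t z)^*.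
Proof.
by rewrite /join_fun1 odd_part_star [RHS]rmorphM [X in _ = X * _]real_conj.
Qed.

Lemma join_fun0_star f t z : join_fun0 (star f) t z = (join_fun0 f t z)^*.
Proof.
rewrite /join_fun0 even_part_star odd_part_star [RHS]rmorphD; congr (_ + _).
by rewrite [RHS]rmorphM [X in _ = X * _]real_conj.
Qed.

(** The antipode sends the spectral value w to minus its conjugate and H to
    itself up to the sign of its first coefficient.  The sign that the odd part
    picks up is therefore cancelled in the coefficient of 1 and survives in that
    of mu, which is the sign of the dual action. *)
Lemma join_fun_antipodal f t z (g := antipodal_action R 1 f) :
  join_fun0 g t z = join_fun0 f t (antipode z) /\
  join_fun1 g t z = - join_fun1 f t (antipode z).
Proof.
have gE w : cf_fun g w = f (antipode w) :> C by [].
have cK := @circle_conjK R.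
rewrite /join_fun0 /join_fun1 join_point_antipode weight0_antipode
  weight1_antipode !partE !gE -!circle_conj_antipode cK rmorphN.
by split; field.
Qed.

Variable P : crossed_product (conjugation_action R).
Local Notation pair := (@cp_pair R cf (conjugation_action R) P).

Let join_map_continuous f :
  continuous (fun t => pair (join_cf0 f t) (join_cf1 f t)).
Proof.
apply: cp_pair_continuous; apply: continuous_into_cont_fun.
  exact: join_fun0_continuous.
exact: join_fun1_continuous.
Qed.

(** The value at t is f(t z + i sqrt (1 - t^2) mu). *)
Definition join_map f : cont_fun I P := mkcf (@join_map_continuous f).

Lemma join_map_hom : unital_star_hom join_map.
Proof.
split=> [c f g|f g||f]; apply: cf_ext => t.
- rewrite [RHS](_ : _ = c *: pair (join_cf0 f t) (join_cf1 f t) +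
    pair (join_cf0 g t) (join_cf1 g t)) // -cp_pairD.
  congr pair; apply: cf_ext => z; first exact: join_fun0P.
  exact: join_fun1P.
- rewrite [RHS](_ : _ = pair (join_cf0 f t) (join_cf1 f t) *
    pair (join_cf0 g t) (join_cf1 g t)) // cp_pairM.
  congr pair; apply: cf_ext => z; first exact: join_fun0M.
  exact: join_fun1M.
- have ih := cp_inj_hom P.
  rewrite [RHS](_ : _ = 1) // -(star_hom1 ih).
  rewrite -[RHS]addr0 -(mul0r (cp_unit P)) -(star_hom0 ih).
  congr pair; apply: cf_ext => z.
    rewrite join_cf0E /join_fun0 !partE !cfE.
    by rewrite subrr mul0r mulr0 addr0 -[X in X + _]/1 divff ?pnatr_eq0.
  by rewrite join_cf1E /join_fun1 !partE !cfE subrr mul0r mulr0.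
- rewrite [RHS](_ : _ = star (pair (join_cf0 f t) (join_cf1 f t))) //.
  rewrite cp_pair_star.
  congr pair; apply: cf_ext => z; first exact: join_fun0_star.
  by rewrite [LHS]join_fun1_star -(join_fun1_conj f t z).
Qed.

(** At t = 0 the spectral value is i for every z and the symmetry is mu, so both
    coefficients are constant; at t = 1 the coefficient of mu is 0. *)
Lemma join_map_join f : twisted_join (join_map f).
Proof.
split.
  set t := unit_interval0 R.
  have t0 : set_val t = 0 :> R by [].
  have rE z : join_radius t z = 1.
    by rewrite /join_radius t0 mul0r expr0n subr0 sqrtr1.
  have w0 z : weight0 t z = 0 by rewrite /weight0 t0 !mul0r.
  have w1 z : weight1 t z = 1.
    by rewrite /weight1 t0 rE expr0n subr0 sqrtr1 divr1.
  have wE z : join_point t z = join_point t (circle_one R).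
    by apply: val_inj; rewrite /= t0 !mul0r !rE.
  rewrite [X in group_cstar X](_ : _ = pair (join_cf0 f t) (join_cf1 f t)) //.
  set w := join_point t (circle_one R) in wE.
  have -> : join_cf0 f t = (even_part f w : C) *: (1 : cf : cstarAlgType R).
    apply: cf_ext => z; rewrite join_cf0E /join_fun0 w0 wE mul0r addr0.
    by rewrite [RHS]mulr1.
  have -> : join_cf1 f t = (odd_part f w : C) *: (1 : cf : cstarAlgType R).
    apply: cf_ext => z; rewrite join_cf1E /join_fun1 w1 wE mul1r.
    by rewrite [RHS]mulr1.
  exact: group_cstar_pair.
set t := unit_interval1 R.
have t1 : set_val t = 1 :> R by [].
exists (join_cf0 f t) => //.
rewrite [RHS](_ : _ = pair (join_cf0 f t) (join_cf1 f t)) //.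
have -> : join_cf1 f t = 0.
  apply: cf_ext => z; rewrite join_cf1E /join_fun1 /weight1 t1 expr1n subrr.
  by rewrite sqrtr0 !mul0r.
by rewrite /cp_pair (star_hom0 (cp_inj_hom P)) mul0r addr0.
Qed.

Lemma join_map_equivariant :
  equivariant (antipodal_action R) (join_action (P := P) (antipodal_action R))
    (fun f => join_map f : I -> P).
Proof.
have gen f : (join_map (antipodal_action R 1 f) : I -> P) =
  cp_twist (antipodal_action R) \o (join_map f : I -> P).
  apply/funext => t /=.
  rewrite [RHS](_ : _ = cp_twist (antipodal_action R)
     (pair (join_cf0 f t) (join_cf1 f t))) // cp_twist_pair.
  congr pair; apply: cf_ext => z; have [E0 E1] := join_fun_antipodal f t z.
    exact: E0.
  exact: E1.
move=> g f; have [->|->] := Z2_cases g.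
- by rewrite act0.
- by rewrite gen.
Qed.

End join_hom.

(** * Freeness *)

Lemma is_character_Z2 (R : realType) (gamma : 'Z_2 -> R[i]) :
  is_character gamma -> gamma 0 = 1 /\ (gamma 1 = 1 \/ gamma 1 = -1).
Proof.
move=> [g1 gD]; have g0 : gamma 0 = 1.
  have /eqP := gD 0 0; rewrite addr0 eq_sym -subr_eq0 -{3}[gamma 0]mulr1 -mulrBr.
  rewrite mulf_eq0 subr_eq0 => /orP[/eqP g0|/eqP //].
  by have := g1 0; rewrite g0 normr0 => /eqP; rewrite eq_sym oner_eq0.
split=> //; have /eqP := gD 1 1; rewrite (_ : 1 + 1 = 0 :> 'Z_2) ?g0.
  by rewrite eq_sym -expr2 sqrf_eq1 => /orP[]/eqP; [left|right].
exact: val_inj.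
Qed.

Lemma mem_linear_span (R : realType) (A : cstarAlgType R) (S : set A) x :
  S x -> linear_span S x.
Proof.
move=> Sx; exists 1%N, (fun=> 1), (fun=> x); split=> //.
by rewrite big_ord1 scale1r.
Qed.

Section freeness.
Variable R : realType.

(** The trivial character is served by 1 and the sign character by the coordinate
    z, as both are unitary. *)
Lemma antipodal_action_free : free_action (antipodal_action R).
Proof.
move=> gamma /is_character_Z2[g0 g1]; apply: subset_closure.
apply: mem_linear_span.
case: g1 => g1.
  exists 1, 1; rewrite star1 mulr1; split=> // g; case: (Z2_cases g) => ->;
    by rewrite ?g0 ?g1 scale1r; apply: cf_ext.
exists (circle_coord R), (circle_coord R); split=> [g|g|];
  try by case: (Z2_cases g) => ->; rewrite ?g0 ?g1 ?scale1r ?act0 //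
    antipodal_action_coord scaleN1r.
apply: cf_ext => z; apply/esym.
rewrite [LHS](_ : _ = (set_val z : R[i]) * (set_val z : R[i])^*) //.
by rewrite -normCK (set_valP z) expr1n.
Qed.

(** A function that conjugation negates vanishes at the fixed point 1, so the
    linear combinations of products of such functions stay at distance at least
    1 from the unit. *)
Lemma conjugation_action_not_free : ~ free_action (conjugation_action R).
Proof.
pose gamma (g : 'Z_2) : R[i] := (-1) ^+ (g : nat).
move=> /(_ gamma).
have gc : is_character gamma.
  split=> [g|g h]; first by rewrite /gamma normrX normrN1 expr1n.
  by case: (Z2_cases g) => ->; case: (Z2_cases h) => ->;
    rewrite /gamma /= ?expr0 ?expr1 ?mul1r ?mulr1 ?mulrNN ?mulr1.
move=> /(_ gc) /=; move/(_ _ (nbhsx_ballx _ 1 ltr01)).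
move=> [_ [[n [c [s [sP ->]]]]]]; rewrite -ball_normE /= => dist_lt1.
set o := circle_one R.
have a0 (a : cont_fun (circle R) (cplx R)) :
    spectral_subspace (conjugation_action R) gamma a -> a o = 0 :> R[i].
  move=> /(_ 1) /(congr1 (fun f : cont_fun (circle R) (cplx R) => f o : R[i])).
  have oE : circle_conj o = o by apply: val_inj; rewrite /= rmorph1.
  rewrite [LHS](_ : _ = a (circle_conj o)) // oE.
  rewrite [RHS](_ : _ = (-1) ^+ 1 * (a o : R[i])) // expr1 mulN1r.
  by move=> /eqP; rewrite -addr_eq0 -mulr2n mulrn_eq0 => /eqP.
have s0 i : cf_fun (s i) o = 0 :> R[i].
  have [a [b [aP bP ->]]] := sP i.
  rewrite [LHS](_ : _ = (a o : R[i]) * (b o : R[i])^*) //.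
  by rewrite a0 // mul0r.
have sum0 : cf_fun (\sum_(i < n) c i *: s i) o = 0 :> R[i].
  pose ev (f : cont_fun (circle R) (cplx R)) : R[i] := cf_fun f o.
  rewrite -[LHS]/(ev _) (big_morph ev (id1 := 0) (op1 := +%R)) //.
  by rewrite big1 // => i _; rewrite /ev cf_scaleE s0 mulr0.
have := le_lt_trans (cf_norm_ge _ o) dist_lt1.
rewrite [X in `|X|](_ : _ = 1 - cf_fun (\sum_(i < n) c i *: s i) o) //.
by rewrite sum0 subr0 normr1 ltxx.
Qed.

End freeness.

(** * The counterexample *)

Theorem theorem3p1 (R : realType) :
  let alpha := antipodal_action R in
  let beta := conjugation_action R in
  [/\ commuting_actions alpha beta,
      inhabited (crossed_product beta),
      forall P : crossed_product beta,
        exists phi : cont_fun (circle R) (cplx R) ->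
                     cont_fun (unit_interval R) P,
          equivariant_hom_to_join alpha phi,
      free_action alpha &
      ~ free_action beta] /\
  ~ (forall (k : nat) (A : cstarAlgType R) (alpha beta : cstar_action 'Z_k A),
       (1 < k)%N ->
       commuting_actions alpha beta ->
       free_action alpha ->
       ~ free_action beta ->
       forall P : crossed_product beta,
         ~ (exists phi : A -> cont_fun (unit_interval R) P,
              equivariant_hom_to_join alpha phi)).
Proof.
move=> alpha beta.
have ab : commuting_actions alpha beta.
  move=> g h f; case: (Z2_cases g) => ->; rewrite ?act0 //.
  case: (Z2_cases h) => ->; rewrite ?act0 //.
  apply: cf_ext => z.
  by rewrite [LHS]/(f (circle_conj (antipode z))) circle_conj_antipode.
have hom (P : crossed_product beta) :
    exists phi : cont_fun (circle R) (cplx R) -> cont_fun (unit_interval R) P,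
      equivariant_hom_to_join alpha phi.
  exists (@join_map R P); split.
  - exact: join_map_hom.
  - exact: join_map_join.
  - exact: join_map_equivariant.
have cp : crossed_product beta by exact: involution_crossed_product.
have afree : free_action alpha by exact: antipodal_action_free.
have bnfree : ~ free_action beta by exact: conjugation_action_not_free.
split; first by split.
by move=> /(_ 2%N _ alpha beta isT ab afree bnfree cp); apply; exact: hom.
Qed.
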